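(* Let $D\subset\mathbb{C}^N$ be a domain with $D=\operatorname{int}(\overline{D})$, and let $\{D_n\}_{n=1}^\infty$ be a sequence of domains in $\mathbb{C}^N$ which approximates $D$ from outside. Let $\mu\in AW(D)$ and $\mu_k\in AW(D_k)$ for $k\in\mathbb{N}$. Assume that a) $\mu(z)\le\mu_m(z)$ for all $m\in\mathbb{N}$ and $z\in D$; b) $\mu_k\to\mu$ as $k\to\infty$ pointwise almost everywhere on $D$. Then $\{K_{D_m,\mu_m}\}_{m=1}^\infty$ converges to $K_{D,\mu}$ locally uniformly on $D\times D$ if and only if for every fixed $t\in D$ $$\lim_{m\to\infty}K_{D_m,\mu_m}(t,t)=K_{D,\mu}(t,t).$$
   Context: A sequence of domains $\{D_n\}$ approximates $D$ from outside if $D\subset D_n$ for all $n$, and for each open $G$ with $\overline{D}\subset G$ one has $D\subset D_m\Subset G$ for all sufficiently large $m$ (where $D_m\Subset G$ means that $\overline{D_m}$ is a compact subset of $G$). A weight on an open set $D\subset\mathbb{C}^N$ is a Lebesgue measurable, real-valued, positive function on $D$ (two weights are identified if equal almost everywhere). For a weight $\mu$, $L^2(D,\mu)$ is the space of Lebesgue measurable complex-valued functions with $\|f\|_\mu^2=\int_D|f|^2\mu\,dV<\infty$ ($dV$ is Lebesgue measure), with scalar product $\langle f|g\rangle_\mu=\int_D f\overline{g}\,\mu\,dV$, and $L^2_H(D,\mu)=H(D)\cap L^2(D,\mu)$, where $H(D)$ is the space of holomorphic functions on $D$. A weight $\mu$ is admissible, written $\mu\in AW(D)$, if $L^2_H(D,\mu)$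 is a closed subspace of $L^2(D,\mu)$ and for every $z\in D$ the evaluation functional $f\mapsto f(z)$ is continuous on $L^2_H(D,\mu)$. For $\mu\in AW(D)$ and $t\in D$, if the class $\{f\in L^2_H(D,\mu): f(t)=1\}$ is nonempty, it has a unique element $\phi_\mu(\cdot,t)$ of minimal norm, and the weighted Bergman kernel is $K_{D,\mu}(z,t)=\phi_\mu(z,t)/\|\phi_\mu(\cdot,t)\|_\mu^2$; if the class is empty, $K_{D,\mu}(\cdot,t)\equiv 0$. Equivalently, $K_{D,\mu}$ is the reproducing kernel of $L^2_H(D,\mu)$: $K_{D,\mu}(\cdot,t)\in L^2_H(D,\mu)$ and $f(t)=\langle f|K_{D,\mu}(\cdot,t)\rangle_\mu$ for all $f\in L^2_H(D,\mu)$. *)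

(* Defs.v *)
From HB Require Import structures.
From mathcomp Require Import all_boot all_order all_algebra.
From mathcomp Require Import all_classical all_reals all_analysis.
From mathcomp Require Import complex.

Set Implicit Arguments.
Unset Strict Implicit.
Unset Printing Implicit Defensive.

Import Order.TTheory GRing.Theory Num.Theory.
Import numFieldNormedType.Exports.

Local Open Scope classical_set_scope.
Local Open Scope ring_scope.

(* The regular module R[i]^o carries the normed-module structure (over R[i])
   that differentiability and uniform convergence rely on. *)
Notation Cplx R := (R[i]^o).

Definition cmod (R : realType) (w : Cplx R) : R :=
  complex.ComplexField.Normc.normc w.

(* C^N with N = n.+1 >= 1. *)
Notation Cn R n := ('rV[Cplx R]_n.+1).

Section lebesgue.
Context {R : realType} {n : nat}.

(* Half-open boxes of C^N seen as R^(2N); a box with some right end below the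
   left end is empty and has volume 0. *)
Definition box (a b : Cn R n) : set (Cn R n) :=
  [set z | forall j : 'I_n.+1,
     (complex.Re (a ord0 j) < complex.Re (z ord0 j) <= complex.Re (b ord0 j)) /\
     (complex.Im (a ord0 j) < complex.Im (z ord0 j) <= complex.Im (b ord0 j))].

Definition box_vol (a b : Cn R n) : R :=
  \prod_(j < n.+1)
     (Num.max 0 (complex.Re (b ord0 j) - complex.Re (a ord0 j)) *
      Num.max 0 (complex.Im (b ord0 j) - complex.Im (a ord0 j))).

Definition box_cover (X : set (Cn R n)) : set (nat -> Cn R n * Cn R n) :=
  [set F | X `<=` \bigcup_k box (F k).1 (F k).2].

Definition lebesgue_outer (X : set (Cn R n)) : \bar R :=
  ereal_inf [set (\sum_(k <oo) (box_vol (F k).1 (F k).2)%:E)%E | F in box_cover X].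

Lemma box_vol_ge0 (a b : Cn R n) : 0 <= box_vol a b.
Proof. by apply: prodr_ge0 => j _; rewrite mulr_ge0// le_max lexx. Qed.

Local Open Scope ereal_scope.

Let vol (ab : Cn R n * Cn R n) : \bar R := (box_vol ab.1 ab.2)%:E.

Let vol_ge0 ab : 0 <= vol ab.
Proof. by rewrite lee_fin box_vol_ge0. Qed.

Let lebesgue_outer_ge0 X : 0 <= lebesgue_outer X.
Proof.
apply: le_ereal_inf_tmp => _ [F _ <-].
by apply: nneseries_ge0 => k _ _; exact: vol_ge0.
Qed.

Let lebesgue_outer0 : lebesgue_outer set0 = 0.
Proof.
apply/eqP; rewrite eq_le lebesgue_outer_ge0 andbT.
apply: ereal_inf_lbound; exists (fun=> (0%R, 0%R)) => //=.
apply: eseries0 => k _ _.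
by rewrite /box_vol big_ord_recl/= subrr maxxx !mul0r.
Qed.

Let le_lebesgue_outer : {homo lebesgue_outer : A B / A `<=` B >-> A <= B}.
Proof.
move=> A B AB; apply: ereal_inf_le_tmp => _ [F BF <-].
by exists F => //; exact: subset_trans BF.
Qed.

Let lebesgue_outer_sigma_subadditive : sigma_subadditive lebesgue_outer.
Proof.
move=> A; have [[i ioo]|] := pselect (exists i, lebesgue_outer (A i) = +oo).
  rewrite (eseries_pinfty _ _ ioo) ?leey// => k _.
  by rewrite -ltNye (lt_le_trans _ (lebesgue_outer_ge0 _)).
rewrite -forallNE => Aoo.
suff add2e (e : {posnum R}) : lebesgue_outer (\bigcup_k A k) <=
    \sum_(i <oo) lebesgue_outer (A i) + e%:num%:E.
  by apply/lee_addgt0Pr => _/posnumP[].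
apply: le_trans (epsilon_trick xpredT _ _); last 2 first.
- by move=> k; exact: lebesgue_outer_ge0.
- by [].
pose P k F := box_cover (A k) F /\
  \sum_(i <oo) vol (F i) <= lebesgue_outer (A k) + (e%:num / (2 ^ k.+1)%:R)%:E.
have [G PG] : {G & forall k, P k (G k)}.
  apply: (@choice _ _ P) => k; rewrite /P.
  have fk : lebesgue_outer (A k) \is a fin_num.
    by rewrite ge0_fin_numE// lt_neqAle leey andbT; exact/eqP/Aoo.
  have ek : (0 < e%:num / (2 ^ k.+1)%:R)%R by [].
  have [_ [F AF <-] Fe] := lb_ereal_inf_adherent ek fk.
  by exists F; split => //; exact/ltW.
have volG_ge0 x : 0 <= (vol \o uncurry G) x by exact: vol_ge0.
apply: (@le_trans _ _ (\esum_(i in setT) (vol \o uncurry G) i)).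
  apply: ereal_inf_lbound => /=.
  have /card_esym/ppcard_eqP[f] := card_nat2.
  exists (uncurry G \o f).
    move=> t [i _ Ait]; have [j _ Gijt] := (PG i).1 _ Ait.
    by exists (f^-1%FUN (i, j)) => //=; rewrite invK ?inE.
  rewrite -(esum_pred_image (vol \o uncurry G) _ xpredT) ?[fun=> _]set_true//.
  by rewrite image_eq.
rewrite (_ : esum _ _ = \sum_(i <oo) \sum_(j <oo ) vol (G i j)); last first.
  pose J : nat -> set (nat * nat) := fun i => [set (i, j) | j in setT].
  rewrite (_ : setT = \bigcup_k J k); last first.
    by rewrite predeqE => -[a b]; split => // _; exists a => //; exists b.
  rewrite esum_bigcupT /=; last 2 first.
    - apply/trivIsetP => i j _ _ ij.
      rewrite predeqE => -[u m] /=; split => //= -[] [_] _ [<-{u} _].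
      by move=> [m' _] [] /esym/eqP; rewrite (negbTE ij).
    - by move=> /= [u m]; exact: vol_ge0.
  rewrite -(image_id [set: nat]) -fun_true esum_pred_image//; last first.
    by move=> u _; exact: esum_ge0.
  apply: eq_eseriesr => /= j _.
  rewrite -(esum_pred_image (vol \o uncurry G) (pair j) predT)//=; last first.
    by move=> ? ? _ _; exact: (@can_inj _ _ _ snd).
  by congr esum; rewrite predeqE => -[a b]; split; move=> [i _ <-]; exists i.
apply: lee_nneseries => [i _ _|i _].
  by apply: nneseries_ge0 => j _ _; exact: vol_ge0.
exact: (PG i).2.
Qed.

HB.instance Definition _ := isOuterMeasure.Build R (Cn R n) lebesgue_outer
  lebesgue_outer0 lebesgue_outer_ge0 le_lebesgue_outer
  lebesgue_outer_sigma_subadditive.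

End lebesgue.

Definition lebesgue_outer_measure (R : realType) (n : nat) :
  {outer_measure set (Cn R n) -> \bar R} := @lebesgue_outer R n.

(* C^N with its Lebesgue (i.e. Caratheodory) measurable sets. *)
Notation CnL R n := (caratheodory_type (lebesgue_outer_measure R n)).

Definition leb (R : realType) (n : nat) : {measure set (CnL R n) -> \bar R} :=
  lebesgue_outer_measure R n.
Arguments leb R n : clear implicits.

Section bergman.
Context {R : realType} {n : nat}.
Local Notation C := (Cplx R).
Local Notation Cn := (Cn R n).
Local Notation CnL := (CnL R n).
Implicit Types (D : set Cn) (mu : Cn -> R) (f g : Cn -> C).

Definition domain D := [/\ open D, connected D & D !=set0].

Definition approximates_from_outside (Ds : nat -> set Cn) D :=
  (forall k, D `<=` Ds k) /\
  (forall G : set Cn, open G -> closure D `<=` G ->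
     \forall m \near \oo,
       [/\ D `<=` Ds m, compact (closure (Ds m)) & closure (Ds m) `<=` G]).

(* Functions on D are represented by total functions, whose values outside of
   D are irrelevant in all that follows. *)

Definition weight D mu :=
  measurable_fun (D : set CnL) (mu : CnL -> R) /\ forall z, D z -> 0 < mu z.

Definition cmeasurable D f :=
  measurable_fun (D : set CnL) ((fun z => complex.Re (f z)) : CnL -> R) /\
  measurable_fun (D : set CnL) ((fun z => complex.Im (f z)) : CnL -> R).

Definition sqnorm D mu f : \bar R :=
  (\int[leb R n]_(z in (D : set CnL)) (cmod (f z) ^+ 2 * mu z)%:E)%E.

Definition L2norm D mu f : R := Num.sqrt (fine (sqnorm D mu f)).

Definition L2 D mu : set (Cn -> C) :=
  [set f | cmeasurable D f /\ (sqnorm D mu f < +oo)%E].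

Definition holomorphic D f := forall z, D z -> differentiable f z.

Definition L2H D mu : set (Cn -> C) := [set f | holomorphic D f] `&` L2 D mu.

(* An element of the L2 space is a class modulo a.e. equality, and so belongs to
   the holomorphic subspace when it has a holomorphic representative. *)
Definition L2H_closed D mu :=
  forall f, L2 D mu f ->
    (forall e : R, 0 < e -> exists2 g, L2H D mu g & L2norm D mu (f \- g) < e) ->
    exists2 g, L2H D mu g & {ae leb R n, forall z, D z -> f z = g z}.

Definition evaluation_continuous D mu (z : Cn) :=
  forall f, L2H D mu f -> forall e : R, 0 < e ->
    exists2 d : R, 0 < d & forall g, L2H D mu g ->
      L2norm D mu (g \- f) < d -> cmod (g z - f z) < e.

Definition admissible D mu :=
  [/\ weight D mu, L2H_closed D mu &
      forall z, D z -> evaluation_continuous D mu z].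

Definition normalized D mu (t : Cn) : set (Cn -> C) :=
  [set f | L2H D mu f /\ f t = 1].

Definition minimal D mu (t : Cn) : set (Cn -> C) :=
  [set f | normalized D mu t f /\
           forall g, normalized D mu t g -> L2norm D mu f <= L2norm D mu g].

Definition min_element D mu (t : Cn) : Cn -> C := xget (cst 0) (minimal D mu t).

(* Meaningful for admissible mu and z, t in D: then a minimal element, if the
   class is nonempty, exists and is unique on D. *)
Definition bergman_kernel D mu (z t : Cn) : C :=
  if `[< normalized D mu t !=set0 >] then
    min_element D mu t z /
      real_complex R (L2norm D mu (min_element D mu t) ^+ 2)
  else 0.

Definition locally_uniform_cvg (A : set (Cn * Cn))
    (F : nat -> Cn * Cn -> C) (G : Cn * Cn -> C) :=
  forall p, A p -> exists2 U : set (Cn * Cn), nbhs p U &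
    {uniform U `&` A, F @ \oo --> G}.

End bergman.

(* Main.v *)
Require Import Defs.
From mathcomp Require Import all_boot all_order all_algebra.
From mathcomp Require Import all_classical all_reals all_analysis.
From mathcomp Require Import measurable_realfun complex.
From mathcomp Require Import ring lra.
Import Order.TTheory GRing.Theory Num.Theory.
Import numFieldNormedType.Exports.
Local Open Scope classical_set_scope.
Local Open Scope ring_scope.

(** Write [kappa_m t := K_(D_m,mu_m)(t,t)] and [kappa t := K_(D,mu)(t,t)]. As
    [D] lies in [D_m] and [mu <= mu_m], the function [K_m(.,t)] restricts to an
    element of the space of [(D, mu)] whose squared norm is at most [kappa_m t].
    Expanding with the reproducing property gives
    [||K_m(.,t) - K(.,t)||^2 <= kappa t - kappa_m t], and therefore
    [|K_m(z,t) - K(z,t)|^2 <= kappa z * (kappa t - kappa_m t)].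
    Pointwise convergence on the diagonal thus controls everything, provided
    that [kappa] is locally bounded and [kappa - kappa_m] is equicontinuous.
    Both follow from [|f s - f t| <= M_t |s - t| ||f||], valid near each [t] for
    all [f] in the space: by completeness, this is uniform boundedness for the
    difference quotients at [t], each [f] being differentiable there. Hence
    [sqrt kappa_m] and [sqrt kappa] are Lipschitz at [t] with the same constant,
    and compactness of small neighbourhoods, which lie in the compact closure of
    some [D_m], concludes. *)

Set Implicit Arguments.
Unset Strict Implicit.
Unset Printing Implicit Defensive.

(** * Modulus, and Lebesgue measurability of the open subsets of C^N *)

(** Caratheodory's criterion tested on boxes: cutting every box of a cover of [X] in two gives
    covers of the parts of [X] inside and outside [S], of no larger total volume. *)
Lemma split_boxes_measurable (R : realType) (n : nat) (S : set (Cn R n)) :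
  (forall a b, exists a1 b1 a2 b2 : Cn R n,
    [/\ box a b `&` S `<=` box a1 b1, box a b `&` ~` S `<=` box a2 b2 &
        box_vol a1 b1 + box_vol a2 b2 <= box_vol a b]) ->
  measurable (S : set (CnL R n)).
Proof.
move=> Ssplit.
have /choice[G GP] (ab : Cn R n * Cn R n) : exists c : (Cn R n * Cn R n) * (Cn R n * Cn R n),
    [/\ box ab.1 ab.2 `&` S `<=` box c.1.1 c.1.2,
        box ab.1 ab.2 `&` ~` S `<=` box c.2.1 c.2.2 &
        box_vol c.1.1 c.1.2 + box_vol c.2.1 c.2.2 <= box_vol ab.1 ab.2].
  have [a1 [b1 [a2 [b2 ?]]]] := Ssplit ab.1 ab.2.
  by exists ((a1, b1), (a2, b2)).
apply: (@le_caratheodory_measurable _ _ (lebesgue_outer_measure R n)) => X.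
apply: le_ereal_inf_tmp => _ [F FX <-].
have vol_ge0 a b : (0%E <= (box_vol a b : R)%:E :> \bar R)%E.
  by rewrite lee_fin box_vol_ge0.
apply: (@le_trans _ _ (\sum_(k <oo) (box_vol (G (F k)).1.1 (G (F k)).1.2)%:E +
    \sum_(k <oo) (box_vol (G (F k)).2.1 (G (F k)).2.2)%:E)%E).
  apply: leeD; apply: ereal_inf_lbound.
    exists (fun k => (G (F k)).1) => //= z [Xz Sz].
    by have [k _ Fz] := FX _ Xz; exists k => //; have [+ _ _] := GP (F k); apply.
  exists (fun k => (G (F k)).2) => //= z [Xz Sz].
  by have [k _ Fz] := FX _ Xz; exists k => //; have [_ + _] := GP (F k); apply.
rewrite -nneseriesD//; apply: lee_nneseries => [k _ _|k _].
  by rewrite -EFinD lee_fin addr_ge0 ?box_vol_ge0.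
by rewrite -EFinD lee_fin; have [_ _] := GP (F k).
Qed.

Definition set_coord (R : realType) (n : nat) (j : 'I_n.+1) (w : Cplx R)
    (a : Cn R n) : Cn R n :=
  \row_k if k == j then w else a ord0 k.

Lemma box_vol_split (R : realType) (n : nat) (a b a1 b1 a2 b2 : Cn R n)
    (j : 'I_n.+1) :
  (forall k, k != j -> [/\ a1 ord0 k = a ord0 k, a2 ord0 k = a ord0 k,
    b1 ord0 k = b ord0 k & b2 ord0 k = b ord0 k]) ->
  (let side (u v : Cn R n) :=
    Num.max 0 (complex.Re (v ord0 j) - complex.Re (u ord0 j)) *
    Num.max 0 (complex.Im (v ord0 j) - complex.Im (u ord0 j)) in
   side a1 b1 + side a2 b2 = side a b) ->
  box_vol a1 b1 + box_vol a2 b2 = box_vol a b.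
Proof.
move=> eqk /= side; rewrite /box_vol [X in X + _](bigD1 j)//= [X in _ + X](bigD1 j)//=.
rewrite [RHS](bigD1 j)//= -side mulrDl.
by congr (_ * _ + _ * _); apply: eq_bigr => k /eqk[e1 e2 e3 e4];
  rewrite ?e1 ?e2 ?e3 ?e4.
Qed.

(** An interval cut at [c], empty intervals having length 0; [c] may lie outside it. *)
Lemma max_split (R : realType) (a b c : R) :
  Num.max 0 (Num.min b c - a) + Num.max 0 (b - Num.max a c) = Num.max 0 (b - a).
Proof.
by have [?|?] := leP b c; have [?|?] := leP a c;
  rewrite /Num.max; repeat (case: ifPn; rewrite -?leNgt => ?); lra.
Qed.

(** A hyperplane cuts a box into two boxes: one has its right end lowered to at most [c] in one real
    coordinate, the other its left end raised to at least [c]. *)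
Lemma halfspace_Re_measurable (R : realType) (n : nat) (j : 'I_n.+1) (c : R) :
  measurable ([set z | complex.Re (z ord0 j) <= c] : set (CnL R n)).
Proof.
apply: split_boxes_measurable => a b.
exists a, (set_coord j
    (Complex (Num.min (complex.Re (b ord0 j)) c) (complex.Im (b ord0 j))) b),
  (set_coord j
    (Complex (Num.max (complex.Re (a ord0 j)) c) (complex.Im (a ord0 j))) a), b.
split=> [z [zab zc] k|z [zab /negP zc] k|].
- have := zab k; rewrite mxE; case: eqP => [->|//] /=.
  by rewrite /= le_min => -[/andP[-> ->] ->].
- have := zab k; rewrite mxE; case: eqP => [->|//] /=.
  by rewrite /= gt_max; rewrite /= -ltNge in zc; rewrite zc => -[/andP[-> ->] ->].
rewrite (@box_vol_split _ _ a b _ _ _ _ j)// => [k /negbTE kj|].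
  by rewrite !mxE kj.
by rewrite /= !mxE eqxx/= -mulrDl max_split.
Qed.

Lemma halfspace_Im_measurable (R : realType) (n : nat) (j : 'I_n.+1) (c : R) :
  measurable ([set z | complex.Im (z ord0 j) <= c] : set (CnL R n)).
Proof.
apply: split_boxes_measurable => a b.
exists a, (set_coord j
    (Complex (complex.Re (b ord0 j)) (Num.min (complex.Im (b ord0 j)) c)) b),
  (set_coord j
    (Complex (complex.Re (a ord0 j)) (Num.max (complex.Im (a ord0 j)) c)) a), b.
split=> [z [zab zc] k|z [zab /negP zc] k|].
- have := zab k; rewrite mxE; case: eqP => [->|//] /=.
  by rewrite /= le_min => -[-> /andP[-> ->]].
- have := zab k; rewrite mxE; case: eqP => [->|//] /=.
  by rewrite /= gt_max; rewrite /= -ltNge in zc; rewrite zc => -[-> /andP[-> ->]].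
rewrite (@box_vol_split _ _ a b _ _ _ _ j)// => [k /negbTE kj|].
  by rewrite !mxE kj.
by rewrite /= !mxE eqxx/= -mulrDr max_split.
Qed.

Lemma box_measurable (R : realType) (n : nat) (a b : Cn R n) :
  measurable (box a b : set (CnL R n)).
Proof.
pose Sr (c : Cn R n) (j : 'I_n.+1) : set (CnL R n) :=
  [set z | complex.Re (z ord0 j) <= complex.Re (c ord0 j)].
pose Si (c : Cn R n) (j : 'I_n.+1) : set (CnL R n) :=
  [set z | complex.Im (z ord0 j) <= complex.Im (c ord0 j)].
rewrite (_ : box a b = \bigcap_j ((~` Sr a j `&` Sr b j) `&` (~` Si a j `&` Si b j))).
  apply: fin_bigcap_measurable => // j _.
  apply: measurableI; apply: measurableI.
  - by apply: measurableC; exact: halfspace_Re_measurable.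
  - exact: halfspace_Re_measurable.
  - by apply: measurableC; exact: halfspace_Im_measurable.
  - exact: halfspace_Im_measurable.
apply/seteqP; split=> z zab j.
  move=> _; have [/andP[h1 h2] /andP[h3 h4]] := zab j.
  by split; split => //; apply/negP; rewrite -ltNge.
have [[/negP h1 h2] [/negP h3 h4]] := zab j I.
by rewrite !ltNge h1 h3 h2 h4.
Qed.

Lemma norm_cmod (R : realType) (w : Cplx R) : `|w| = (cmod w)%:C%C.
Proof. by []. Qed.

Lemma cmod_ge0 (R : realType) (w : Cplx R) : 0 <= cmod w.
Proof. by case: w => a b; exact: sqrtr_ge0. Qed.

Lemma cmod_sqr (R : realType) (w : Cplx R) :
  cmod w ^+ 2 = complex.Re w ^+ 2 + complex.Im w ^+ 2.
Proof. by case: w => a b; rewrite sqr_sqrtr// addr_ge0// sqr_ge0. Qed.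

Lemma cmodM (R : realType) (v w : Cplx R) : cmod (v * w) = cmod v * cmod w.
Proof. exact: ComplexField.Normc.normcM. Qed.

Lemma cmodD_le (R : realType) (v w : Cplx R) : cmod (v + w) <= cmod v + cmod w.
Proof. by rewrite -lecR rmorphD/= -!norm_cmod ler_normD. Qed.

Lemma cmodN (R : realType) (w : Cplx R) : cmod (- w) = cmod w.
Proof. by apply: complexI; rewrite -!norm_cmod normrN. Qed.

Lemma cmod_real (R : realType) (x : R) : cmod (x%:C%C : Cplx R) = `|x|.
Proof. by rewrite /cmod /= expr0n addr0 sqrtr_sqr. Qed.

Lemma cmod_ReIm_lt (R : realType) (w : Cplx R) (e : R) :
  `|complex.Re w| < e -> `|complex.Im w| < e -> cmod w < 2 * e.
Proof.
move=> re ime; have e0 : 0 < e by exact: le_lt_trans re.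
rewrite -(@ltr_pXn2r _ 2)// ?nnegrE ?cmod_ge0 ?mulr_ge0 ?ltW//.
rewrite cmod_sqr -(real_normK (num_real (complex.Re w))).
rewrite -(real_normK (num_real (complex.Im w))).
have := normr_ge0 (complex.Re w); have := normr_ge0 (complex.Im w); nra.
Qed.

Lemma row_norm_lt (R : realType) (n : nat) (z : Cn R n) (e : Cplx R) :
  (forall k, `|z ord0 k| < e) -> `|z| < e.
Proof.
move=> ze; have [->|z0] := eqVneq `|z| 0; first by exact: le_lt_trans (ze ord0).
have [[i k] /= zik] := mx_norm_neq0 z0.
by rewrite [`|z|]zik (ord1 i).
Qed.

(** [D] is the union of the countably many boxes with rational end points that it contains. *)
Lemma open_measurable_Cn (R : realType) (n : nat) (D : set (Cn R n)) :
  open D -> measurable (D : set (CnL R n)).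
Proof.
move=> oD.
pose rC (p : rat * rat) : Cplx R := Complex (ratr p.1) (ratr p.2).
pose rCn (p : {ffun 'I_n.+1 -> rat * rat}) : Cn R n := \row_k rC (p k).
pose I := ({ffun 'I_n.+1 -> rat * rat} * {ffun 'I_n.+1 -> rat * rat})%type.
pose B (p : I) : set (CnL R n) :=
  if `[< box (rCn p.1) (rCn p.2) `<=` D >] then box (rCn p.1) (rCn p.2) else set0.
rewrite (_ : D = \bigcup_p B p); last first.
  apply/seteqP; split => [z Dz|z [p _]]; last first.
    by rewrite /B; case: asboolP => // + zp; apply.
  have := oD; rewrite openE => /(_ z Dz) /nbhs_normP[e /= e0 eD].
  have ere : e = (complex.Re e)%:C%C by rewrite RRe_real// gtr0_real.
  (* Half the radius, since real and imaginary parts within [d] of those of [z] only bound the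
     modulus by [2 * d]. *)
  pose d := complex.Re e / 2.
  have d0 : 0 < d by rewrite divr_gt0// -ltcR -ere.
  have /choice[q qP] (k : 'I_n.+1) : exists q : (rat * rat) * (rat * rat),
     [/\ complex.Re (z ord0 k) - d < ratr q.1.1 < complex.Re (z ord0 k),
      complex.Im (z ord0 k) - d < ratr q.1.2 < complex.Im (z ord0 k),
      complex.Re (z ord0 k) < ratr q.2.1 < complex.Re (z ord0 k) + d &
      complex.Im (z ord0 k) < ratr q.2.2 < complex.Im (z ord0 k) + d].
    have [|q1] := @rat_in_itvoo R (complex.Re (z ord0 k) - d) (complex.Re (z ord0 k)).
      by rewrite ltrBlDr ltrDl.
    have [|q2] := @rat_in_itvoo R (complex.Im (z ord0 k) - d) (complex.Im (z ord0 k)).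
      by rewrite ltrBlDr ltrDl.
    have [|q3] := @rat_in_itvoo R (complex.Re (z ord0 k)) (complex.Re (z ord0 k) + d).
      by rewrite ltrDl.
    have [|q4] := @rat_in_itvoo R (complex.Im (z ord0 k)) (complex.Im (z ord0 k) + d).
      by rewrite ltrDl.
    rewrite !in_itv/= => h4 h3 h2 h1.
    by exists ((q1, q2), (q3, q4)).
  exists ([ffun k => (q k).1], [ffun k => (q k).2]) => //; rewrite /B.
  case: asboolP => [_|[]].
    move=> k; rewrite !mxE !ffunE /=.
    by have [/andP[_ ->] /andP[_ ->] /andP[/ltW -> _] /andP[/ltW -> _]] := qP k.
  move=> y yq; apply: eD => /=.
  rewrite ere; apply: row_norm_lt => k.
  rewrite !mxE (_ : complex.Re e = 2 * d); last by rewrite mulrC divfK.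
  have := yq k; rewrite !mxE !ffunE /=.
  have [] := qP k; case: (z ord0 k) => zr zi; case: (y ord0 k) => yr yi /=.
  move=> h1 h2 h3 h4 [h5 h6]; rewrite norm_cmod ltcR.
  apply: cmod_ReIm_lt => /=; rewrite ltr_norml; lra.
apply: countable_bigcupT_measurable; first exact: countableP.
move=> p; rewrite /B; case: asboolP => _ //; exact: box_measurable.
Qed.

(** * Complete quadratic function spaces: minimal elements and reproducing kernels *)

(* No inner product is needed: [hilb_line] says that [Q] is quadratic along
   lines, which is all that minimality arguments use. *)
Record hilbertian (R : realType) (T : Type) (H : set (T -> Cplx R))
    (Q : (T -> Cplx R) -> R) : Prop := {
  hilb0 : H 0;
  hilbP : forall (c : R[i]) f g, H f -> H g -> H (c *: f + g);
  hilb_ge0 : forall f, 0 <= Q f;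
  hilbZ : forall (c : R[i]) f, H f -> Q (c *: f) = cmod c ^+ 2 * Q f;
  hilb_line : forall (r : R) f h, H f -> H h ->
    Q (f + r%:C%C *: h) = (1 - r) * Q f + r * Q (f + h) - r * (1 - r) * Q h;
  hilb_complete : forall u : nat -> T -> Cplx R, (forall k, H (u k)) ->
    (forall k, Q (u k.+1 - u k) <= 16^-1 ^+ k) ->
    exists2 g, H g & exists C, forall k, Q (g - u k) <= C * 4^-1 ^+ k
}.

(** The discriminant test. For [S > 0] it is read off at the vertex; [S = 0] forces [b = 0], and
    [S < 0] is impossible. *)
Lemma quadratic_ge0 (R : realFieldType) (A b S : R) :
  (forall r, 0 <= A + r * b + r ^+ 2 * S) -> b ^+ 2 <= 4 * A * S.
Proof.
move=> q; have [S0|S0] := eqVneq S 0.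
  have [->|b0] := eqVneq b 0; first by rewrite S0 mulr0 expr0n.
  have := q (- (A + 1) / b); rewrite S0 mulr0 addr0 divfK//; lra.
have := q (- b / (2 * S)).
rewrite (_ : _ + _ = A - b ^+ 2 / (4 * S)); last by field; rewrite S0.
have [Sp|Sn _|] := ltrgtP 0 S; last by move/eqP; rewrite eq_sym (negbTE S0).
  by rewrite subr_ge0 ler_pdivrMr ?mulr_gt0//; lra.
have A0 := q 0; have := q 1; have := q (-1).
(* For [S < 0], the quadratic term at this point outweighs both [A] and the linear term. *)
have := q ((1 + A + `|b|) / `|S| + 1).
have Sg : 0 < `|S| by rewrite normr_gt0.
set x := (1 + A + `|b|) / `|S|.
have xS : x * S = - (1 + A + `|b|).
  by rewrite /x (ltr0_norm Sn); field.
have xp : 0 <= x by rewrite divr_ge0// ?ltW//; have := normr_ge0 b; lra.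
have : b <= `|b| by exact: ler_norm.
have := normr_ge0 b.
rewrite (_ : _ ^+ 2 * S = (x + 1) * (x * S + S)); last by ring.
rewrite xS; nra.
Qed.

(** The discriminant test with [A = 0]; it serves as the first-order condition at a minimum. *)
Lemma quadratic_ge0_linear (R : realFieldType) (b S : R) : 0 <= S ->
  (forall r, 0 <= r * b + r ^+ 2 * S) -> b = 0.
Proof.
move=> S0 q; have := @quadratic_ge0 _ 0 b S.
rewrite mulr0 mul0r => /(_ _)/wrap[|b2]; first by move=> r; rewrite add0r.
by apply/eqP; rewrite -sqrf_eq0 eq_le b2 sqr_ge0.
Qed.

Lemma le_geometric0 (R : realType) (x C : R) :
  (forall k, x <= C * 2^-1 ^+ k) -> x <= 0.
Proof.
move=> xC; have h : geometric C 2^-1 @ \oo --> (0 : R).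
  by apply: cvg_geometric; rewrite ger0_norm ?invr_ge0// invf_lt1// ltr1n.
rewrite -(cvg_lim _ h)//; apply: limr_ge; first by apply/cvg_ex; exists 0.
exact: nearW.
Qed.

Section hilbertian_space.
Context (R : realType) (T : Type) (H : set (T -> Cplx R))
  (Q : (T -> Cplx R) -> R).
Hypothesis hH : hilbertian H Q.
Implicit Types (f g h : T -> Cplx R) (t : T).

Definition qnorm f := Num.sqrt (Q f).
Local Notation N := qnorm.

Definition bounded_evaluation t :=
  exists C, forall f, H f -> cmod (f t) <= C * N f.

Let Q_ge0 := hilb_ge0 hH.

Lemma hilbZr (c : R[i]) f : H f -> H (c *: f).
Proof. by move=> Hf; rewrite -[c *: f]addr0; apply: hilbP hH _ _ _ Hf (hilb0 hH). Qed.

Lemma hilbD f g : H f -> H g -> H (f + g).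
Proof. by move=> Hf Hg; rewrite -[f]scale1r; exact: hilbP hH _ _ _ Hf Hg. Qed.

Lemma hilbB f g : H f -> H g -> H (f - g).
Proof. by move=> Hf Hg; rewrite addrC -scaleN1r; exact: hilbP hH _ _ _ Hg Hf. Qed.

Lemma qnorm_ge0 f : 0 <= N f.
Proof. exact: sqrtr_ge0. Qed.

Lemma qnorm_sqr f : N f ^+ 2 = Q f.
Proof. by rewrite sqr_sqrtr. Qed.

Lemma qnormZ (c : R[i]) f : H f -> N (c *: f) = cmod c * N f.
Proof.
move=> Hf; rewrite /qnorm (hilbZ hH)// sqrtrM ?sqr_ge0//.
by rewrite sqrtr_sqr ger0_norm// cmod_ge0.
Qed.

Lemma qnorm0 : N 0 = 0.
Proof.
rewrite -(scale0r (0 : T -> Cplx R)) qnormZ; last exact: hilb0 hH.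
by rewrite -[0 : R[i]]/(0%:C)%C cmod_real normr0 mul0r.
Qed.

(** The identity [hilb_line] at [r = -1]. *)
Lemma parallelogram f g : H f -> H g ->
  Q (f + g) + Q (f - g) = 2 * Q f + 2 * Q g.
Proof.
move=> Hf Hg; have := hilb_line hH (-1) Hf Hg.
by rewrite rmorphN1 scaleN1r => ->; ring.
Qed.

(** [Q (f + g) - Q f - Q g] plays the role of twice the real part of the inner product; the
    discriminant test along the line through [f] in direction [g] is Cauchy-Schwarz for it. *)
Lemma qnormD f g : H f -> H g -> N (f + g) <= N f + N g.
Proof.
move=> Hf Hg; have bQ : (Q (f + g) - Q f - Q g) ^+ 2 <= 4 * Q f * Q g.
  apply: quadratic_ge0 => r; rewrite [X in 0 <= X](_ : _ = Q (f + r%:C%C *: g)) ?Q_ge0//.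
  by rewrite (hilb_line hH)//; ring.
rewrite -(@ler_pXn2r _ 2)// ?nnegrE ?addr_ge0 ?qnorm_ge0//.
rewrite sqrrD !qnorm_sqr.
suff : Q (f + g) - Q f - Q g <= N f * N g *+ 2 by lra.
apply: (le_trans (ler_norm _)); rewrite -(@ler_pXn2r _ 2)// ?nnegrE//; last first.
  by rewrite mulrn_wge0// mulr_ge0// qnorm_ge0.
rewrite real_normK ?num_real//; apply: (le_trans bQ).
by rewrite -!qnorm_sqr le_eqVlt; apply/orP; left; apply/eqP; ring.
Qed.

Lemma bounded_of_ball (L : (T -> Cplx R) -> Cplx R) (d m : R) : 0 < d ->
  (forall (c : R[i]) f, H f -> L (c *: f) = c *: L f) ->
  (forall f, H f -> N f <= d -> cmod (L f) <= m) ->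
  forall f, H f -> cmod (L f) <= m / d * N f.
Proof.
move=> d0 LZ Lb f Hf; apply/ler_addgt0Pr => e e0.
have m0 : 0 <= m.
  apply: (le_trans (cmod_ge0 (L 0))); apply: Lb; first exact: hilb0 hH.
  by rewrite qnorm0 ltW.
(* [N f] may vanish: the extra term keeps [s] positive and costs at most [e] in the final bound. *)
pose s := N f + e * d / (m + 1).
have s0 : 0 < s by rewrite ltr_wpDl ?qnorm_ge0// divr_gt0 ?mulr_gt0//; lra.
have := Lb ((d / s)%:C%C *: f) (hilbZr _ Hf).
rewrite LZ// cmodM qnormZ// !cmod_real ger0_norm; last by rewrite divr_ge0 ?ltW.
move=> /(_ _)/wrap[|].
  rewrite mulrAC ler_pdivrMr// ler_pM2l// /s lerDl.
  by rewrite divr_ge0 ?mulr_ge0//; lra.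
rewrite mulrAC ler_pdivrMr// -ler_pdivlMl// => /le_trans; apply.
rewrite /s mulrDr mulrDr (_ : _ + _ = m / d * N f + m / (m + 1) * e); last first.
  by field; lra.
by rewrite lerD2l ler_piMl ?ltW// ltr_pdivrMr//; lra.
Qed.

Lemma hilbert_complete (u : nat -> T -> Cplx R) : (forall k, H (u k)) ->
  (forall k, Q (u k.+1 - u k) <= 16^-1 ^+ k) ->
  exists2 g, H g & exists C, forall k, N (g - u k) <= C * 2^-1 ^+ k.
Proof.
move=> Hu /(hilb_complete hH Hu)[g Hg [C uC]]; exists g => //.
exists (Num.sqrt C) => k; rewrite /qnorm.
have C0 : 0 <= C by have := uC 0; rewrite expr0 mulr1; exact: le_trans.
rewrite (_ : 2^-1 ^+ k = Num.sqrt (4^-1 ^+ k)).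
  by rewrite -sqrtrM// ler_wsqrtr.
rewrite (_ : 4^-1 = 2^-1 ^+ 2); last by field.
by rewrite exprAC sqrtr_sqr ger0_norm// exprn_ge0// invr_ge0.
Qed.

Lemma bounded_evaluation_lim t g (u : nat -> T -> Cplx R) (c : Cplx R) C :
  bounded_evaluation t -> H g -> (forall k, H (u k)) ->
  (forall k, N (g - u k) <= C * 2^-1 ^+ k) -> (forall k, u k t = c) -> g t = c.
Proof.
move=> [M tM] Hg Hu uC ut; apply/subr0_eq/ComplexField.Normc.eq0_normc.
apply/eqP; rewrite eq_le cmod_ge0 andbT; apply: (@le_geometric0 _ _ (`|M| * C)) => k.
rewrite -(ut k); apply: (le_trans (tM _ (hilbB Hg (Hu k)))).
apply: (@le_trans _ _ (`|M| * N (g - u k))).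
  by rewrite ler_wpM2r ?qnorm_ge0// ler_norm.
by rewrite -mulrA ler_wpM2l.
Qed.

(** A minimizing sequence has geometrically small steps by the parallelogram law; bounded evaluation
    keeps the value 1 at [t] in the limit. *)
Lemma minimal_exists t : bounded_evaluation t ->
  (exists2 f, H f & f t = 1) ->
  exists phi, [/\ H phi, phi t = 1 &
    forall g, H g -> g t = 1 -> Q phi <= Q g].
Proof.
move=> tb [f0 Hf0 f0t].
pose E := [set Q f | f in [set f | H f /\ f t = 1]].
have infE : has_inf E.
  by split; [exists (Q f0), f0|exists 0 => _ [f _ <-]].
have a_le f : H f -> f t = 1 -> inf E <= Q f.
  by move=> Hf ft; apply: (ge_inf infE.2); exists f.
(* With this tolerance the parallelogram law gives steps of at most [(1/32 + 1/2) * 16^-k], within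
   what completeness asks for. *)
have /choice[u uP] (k : nat) : exists f, [/\ H f, f t = 1 &
    Q f <= inf E + 16^-1 ^+ k / 4].
  have e0 : 0 < 16^-1 ^+ k / 4 :> R by rewrite divr_gt0// exprn_gt0.
  by have [_ [f [Hf ft] <-] /ltW fE] := inf_adherent e0 infE; exists f.
have Hu k : H (u k) by case: (uP k).
have ut k : u k t = 1 by case: (uP k).
have [|phi Hphi [C uC]] := hilbert_complete Hu.
  move=> k.
  (* The midpoint also takes the value 1 at [t], so its [Q] is at least [inf E]. *)
  have Hm : H (2^-1%:C%C *: (u k.+1 + u k)) by apply/hilbZr/hilbD.
  have := a_le _ Hm; rewrite (hilbZ hH); last exact: hilbD.
  have -> : (2^-1%:C%C *: (u k.+1 + u k)) t = 1.
    rewrite [LHS](_ : _ = 2^-1%:C%C * (u k.+1 t + u k t) :> R[i])// !ut.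
    by rewrite -[1 : R[i]]/(1%:C)%C -rmorphD -rmorphM/=; congr (_%:C)%C; field.
  rewrite cmod_real ger0_norm ?invr_ge0// => /(_ erefl).
  have := parallelogram (Hu k.+1) (Hu k).
  have [_ _] := uP k; have [_ _] := uP k.+1.
  rewrite exprS; set d := 16^-1 ^+ k; rewrite (_ : 2^-1 ^+ 2 = 4^-1); last by field.
  have : 0 <= d by rewrite exprn_ge0// invr_ge0.
  lra.
have phit : phi t = 1 by exact: bounded_evaluation_lim tb Hphi Hu uC ut.
exists phi; split => // g Hg gt.
suff : N phi <= Num.sqrt (inf E).
  have E0 : 0 <= inf E by apply: lb_le_inf; [exists (Q f0), f0|move=> _ [f _ <-]].
  rewrite ler_sqrt// => /le_trans; apply; exact: a_le.
(* [C] accounts for the distance from [u k] to [phi], and 1 for the excess of [N (u k)] over the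
   root of the infimum. *)
rewrite -subr_le0; apply: (@le_geometric0 _ _ (C + 1)) => k.
rewrite lerBlDl; apply: (@le_trans _ _ (N (u k) + N (phi - u k))).
  by rewrite -[in leLHS](subrK (u k) phi) addrC qnormD//; exact: hilbB.
rewrite mulrDl mul1r [leRHS]addrA [leRHS]addrAC lerD//.
have [_ _ uE] := uP k; apply: (le_trans (ler_wsqrtr uE)).
rewrite -(@ler_pXn2r _ 2)// ?nnegrE ?sqrtr_ge0 ?addr_ge0 ?sqrtr_ge0 ?exprn_ge0 ?invr_ge0//.
have E0 : 0 <= inf E by apply: lb_le_inf; [exists (Q f0), f0|move=> _ [f _ <-]].
rewrite sqrrD !sqr_sqrtr// ?addr_ge0 ?divr_ge0 ?exprn_ge0 ?invr_ge0//.
rewrite -addrA lerD2l -exprM mulnC exprM.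
rewrite (_ : 2^-1 ^+ 2 = 4^-1 :> R); last by field.
apply: ler_wpDl; first by rewrite mulrn_wge0// mulr_ge0 ?sqrtr_ge0 ?exprn_ge0 ?invr_ge0.
have : 16^-1 ^+ k <= 4^-1 ^+ k :> R.
  by apply: lerXn2r; rewrite ?nnegrE ?invr_ge0// lef_pV2 ?posrE//; lra.
have : 0 <= 16^-1 ^+ k :> R by rewrite exprn_ge0// invr_ge0.
lra.
Qed.

(** Adding real multiples of [h] to [phi] keeps the value 1 at [t], so the first-order condition
    makes them orthogonal; homogeneity then brings in the complex factor [c]. *)
Lemma minimal_orthogonal t phi h : H phi -> phi t = 1 ->
  (forall g, H g -> g t = 1 -> Q phi <= Q g) -> H h -> h t = 0 ->
  forall c : R[i], Q (c *: phi + h) = cmod c ^+ 2 * Q phi + Q h.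
Proof.
move=> Hphi phit phimin Hh ht.
have orth g : H g -> g t = 0 -> Q (phi + g) = Q phi + Q g.
  move=> Hg gt; suff : Q (phi + g) - Q phi - Q g = 0 by lra.
  apply: (@quadratic_ge0_linear _ _ (Q g)) => // r.
  have := phimin (phi + r%:C%C *: g) (hilbD Hphi (hilbZr _ Hg)).
  rewrite (hilb_line hH)// => /(_ _)/wrap[|]; last by lra.
  by rewrite [LHS](_ : _ = phi t + r%:C%C *: g t)// phit gt scaler0 addr0.
move=> c; have [->|c0] := eqVneq c 0.
  by rewrite scale0r add0r -[0 : R[i]]/(0%:C)%C cmod_real normr0 expr0n mul0r add0r.
have HV : H (c^-1 *: h) by exact: hilbZr.
have -> : c *: phi + h = c *: (phi + c^-1 *: h).
  by rewrite scalerDr scalerA mulfV// scale1r.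
rewrite (hilbZ hH); last exact: hilbD.
rewrite orth//; last by rewrite [LHS](_ : _ = c^-1 *: h t)// ht scaler0.
by rewrite mulrDr -(hilbZ hH c HV) scalerA mulfV// scale1r.
Qed.

(* The last clause is [Re <f, k> = Re (f t)], expressed through norms. *)
Definition reproducing t k (kappa : R) :=
  [/\ H k, k t = kappa%:C%C, Q k = kappa &
      forall f, H f -> Q (f - k) = Q f - 2 * complex.Re (f t) + kappa].

(** Each [f] splits into [f t *: phi] and a function vanishing at [t], which [minimal_orthogonal]
    makes orthogonal to [phi]. *)
Lemma minimal_reproducing t phi : bounded_evaluation t ->
  H phi -> phi t = 1 -> (forall g, H g -> g t = 1 -> Q phi <= Q g) ->
  reproducing t ((Q phi)^-1%:C%C *: phi) (Q phi)^-1.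
Proof.
move=> [M tM] Hphi phit phimin.
have a0 : 0 < Q phi.
  rewrite lt_neqAle Q_ge0 andbT eq_sym; apply/eqP => Q0.
  have := tM _ Hphi; rewrite phit /qnorm Q0 sqrtr0 mulr0.
  by rewrite -[1 : Cplx R]/(1%:C)%C cmod_real normr1; lra.
split.
- exact: hilbZr.
- by rewrite [LHS](_ : _ = (Q phi)^-1%:C%C * phi t)// phit mulr1.
- rewrite (hilbZ hH)// cmod_real ger0_norm ?invr_ge0// expr2 -mulrA mulVf ?mulr1//.
  by rewrite gt_eqF.
move=> f Hf; pose c : R[i] := f t; pose h := f - c *: phi.
have Hh : H h by apply: hilbB => //; exact: hilbZr.
have ht : h t = 0.
  by rewrite [LHS](_ : _ = f t - c * phi t)// phit mulr1 subrr.
have fE : f = c *: phi + h by rewrite /h addrC subrK.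
have -> : f - (Q phi)^-1%:C%C *: phi = (c - (Q phi)^-1%:C%C) *: phi + h.
  by rewrite {1}fE scalerBl addrAC.
rewrite [in Q f]fE.
rewrite !(minimal_orthogonal Hphi phit phimin Hh ht).
rewrite !cmod_sqr -/c; case: (c) => x y /=; field.
by rewrite gt_eqF.
Qed.

(** Cauchy-Schwarz against the kernel. Multiplying [f] by the conjugate of [f t] makes its value at
    [t] real, and the reproducing identity for real multiples of this function gives a nonnegative
    quadratic. *)
Lemma reproducing_bound t k kappa f : reproducing t k kappa -> H f ->
  cmod (f t) ^+ 2 <= kappa * Q f.
Proof.
move=> [Hk kt Qk kP] Hf; set w := f t.
pose c : R[i] := (w^*)%C.
have q (r : R) : 0 <= kappa + r * (- 2 * cmod w ^+ 2) + r ^+ 2 * (cmod w ^+ 2 * Q f).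
  have := kP ((r%:C%C * c) *: f) (hilbZr _ Hf).
  rewrite (hilbZ hH)// => Qe; have := Q_ge0 ((r%:C%C * c) *: f - k); rewrite Qe.
  rewrite [_ t](_ : _ = r%:C%C * c * w)// cmodM cmod_real exprMn real_normK ?num_real//.
  rewrite (_ : cmod c = cmod w); last first.
    by apply: complexI; rewrite -!norm_cmod normcJ.
  rewrite (_ : complex.Re _ = r * cmod w ^+ 2); first by lra.
  rewrite cmod_sqr /GRing.scale /= /c; case: (w) => x y /=; ring.
have := quadratic_ge0 q; have [->|w0] := eqVneq (cmod w) 0.
  by rewrite expr0n => _; rewrite mulr_ge0// -Qk.
have w2 : 0 < cmod w ^+ 2 by rewrite exprn_gt0// lt_neqAle eq_sym w0 cmod_ge0.
nra.
Qed.

End hilbertian_space.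

(** * Baire category and comparison of kernels *)

Section hilbertian_baire.
Context (R : realType) (T : Type) (H : set (T -> Cplx R))
  (Q : (T -> Cplx R) -> R).
Hypothesis hH : hilbertian H Q.
Implicit Types (f g h : T -> Cplx R) (t : T).
Local Notation N := (qnorm Q).

(** Baire category. If no [B k] contained a ball, nested balls could be chosen to avoid each [B k]
    in turn; by completeness their centres converge to a point of [H] outside every [B k]. *)
Lemma hilbertian_baire (B : nat -> set (T -> Cplx R)) :
  (forall k f, H f -> ~ B k f ->
    exists2 d, 0 < d & forall g, H g -> N (g - f) <= d -> ~ B k g) ->
  (forall f, H f -> exists k, B k f) ->
  exists k f d, [/\ H f, 0 < d & forall g, H g -> N (g - f) <= d -> B k g].
Proof.
move=> Bclosed Bcover; apply: contrapT => noball.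
(* [G] shrinks a ball to one inside it that misses the set of the given stage; the factor 4 on radii
   yields the rate that completeness asks for. *)
have /choice[G GP] (p : nat * ((T -> Cplx R) * R)) : exists q : (T -> Cplx R) * R,
    H p.2.1 -> 0 < p.2.2 -> [/\ H q.1, 0 < q.2 <= p.2.2 / 4,
      N (q.1 - p.2.1) + q.2 <= p.2.2 &
      forall g, H g -> N (g - q.1) <= q.2 -> ~ B p.1 g].
  case: p => k [f d] /=.
  have [Hf|nHf] := pselect (H f); last by exists (f, d).
  have [d0|nd0] := pselect (0 < d); last by exists (f, d).
  have [g [Hg gf nBg]] : exists g, [/\ H g, N (g - f) <= d / 2 & ~ B k g].
    apply: contrapT => nog; apply: noball; exists k, f, (d / 2); split => //.
      by rewrite divr_gt0.
    by move=> g Hg gf; apply: contrapT => nBg; apply: nog; exists g.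
  have [e e0 eP] := Bclosed _ _ Hg nBg.
  exists (g, Num.min e (d / 4)) => _ _ /=; split => //.
  - by rewrite lt_min e0 divr_gt0//= ge_min lexx orbT.
  - have : Num.min e (d / 4) <= d / 4 by rewrite ge_min lexx orbT.
    lra.
  - by move=> h Hh; rewrite le_min => /andP[he _]; exact: eP.
pose fix x k : (T -> Cplx R) * R := if k is k'.+1 then G (k', x k') else (0, 1).
have xP k : H (x k).1 /\ 0 < (x k).2 <= 4^-1 ^+ k.
  elim: k => [|k [IH /andP[IH0 IH4]]] /=.
    by split; [exact: hilb0 hH|rewrite ltr01 expr0 lexx].
  have [Hx /andP[x0 xle] _ _] := GP (k, x k) IH IH0; split => //.
  by rewrite x0 exprS (le_trans xle)//= mulrC ler_pM2l// invr_gt0.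
have Hx k : H (x k).1 by case: (xP k).
have x0 k : 0 < (x k).2 by case: (xP k) => _ /andP[].
have xN k : N ((x k.+1).1 - (x k).1) + (x k.+1).2 <= (x k).2.
  by have [] := GP (k, x k) (Hx k) (x0 k).
have nest k i : N ((x (k + i)%N).1 - (x k).1) + (x (k + i)%N).2 <= (x k).2.
  elim: i => [|i IH]; first by rewrite addn0 subrr (qnorm0 hH) add0r.
  rewrite addnS; have := xN (k + i)%N.
  have := qnormD hH (hilbB hH (Hx (k + i).+1) (Hx (k + i)%N)) (hilbB hH (Hx (k + i)%N) (Hx k)).
  rewrite addrA subrK; lra.
have [||g Hg [C gC]] := hilbert_complete hH (u := fun k => (x k).1) => //.
  move=> k; rewrite -(qnorm_sqr hH) (_ : 16^-1 = 4^-1 ^+ 2); last by field.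
  rewrite exprAC lerXn2r ?nnegrE ?qnorm_ge0 ?exprn_ge0 ?invr_ge0//.
  have [_ /andP[_ xk]] := xP k; have := xN k; have := x0 k.+1; lra.
have [k Bk] := Bcover _ Hg.
(* The ball with index [k.+1] misses [B k]; it remains to see that the limit [g] lies in it. *)
have [_ _ _ /(_ g Hg)] := GP (k, x k) (Hx k) (x0 k); apply => //.
rewrite -[G _]/(x k.+1) -subr_le0.
apply: (@le_geometric0 _ _ (C * 2^-1 ^+ k.+1)) => i.
rewrite -mulrA -exprD; have := gC (k.+1 + i)%N; have := nest k.+1 i.
have := x0 (k.+1 + i)%N.
have := qnormD hH (hilbB hH Hg (Hx (k.+1 + i)%N)) (hilbB hH (Hx (k.+1 + i)%N) (Hx k.+1)).
rewrite addrA subrK; lra.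
Qed.

(* Uniform boundedness of the difference quotients at [t]; this stands in for
   Cauchy estimates, and needs differentiability at [t] only. *)
Lemma evaluation_lipschitz t (dist : T -> R) (rho : R) : 0 < rho ->
  (forall s, 0 <= dist s) -> dist t = 0 ->
  (forall s, dist s < rho -> bounded_evaluation H Q s) ->
  (forall f, H f -> exists M r : R, 0 < r /\
    forall s, dist s < r -> cmod (f s - f t) <= M * dist s) ->
  exists M r : R, [/\ 0 <= M, 0 < r & forall s, dist s < r ->
    forall f, H f -> cmod (f s - f t) <= M * dist s * N f].
Proof.
move=> rho0 dist0 distt evb lip.
(* A single index both raises the bound on the quotients and shrinks the radius, so countably many
   sets suffice. *)
pose B (k : nat) : set (T -> Cplx R) := [set f | forall s, dist s < rho / k.+1%:R ->
   cmod (f s - f t) <= k%:R * dist s].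
have rk_le k : rho / k.+1%:R <= rho.
  by rewrite ler_pdivrMr ?ltr0n// ler_peMr ?ler1n// ltW.
have [||k [f [d [Hf d0 fB]]]] := hilbertian_baire (B := B).
(* A violation at one point [s] persists near [f], because evaluation at [s] and at [t] is
   bounded. *)
- move=> k f Hf /existsNP[s /not_implyP[srho /negP]]; rewrite -ltNge => fs.
  have [Cs sC] := evb s (lt_le_trans srho (rk_le k)).
  have [Ct tC] : bounded_evaluation H Q t by apply: evb; rewrite distt.
  pose C := `|Cs| + `|Ct| + 1.
  have C0 : 0 < C by rewrite ltr_wpDl// addr_ge0.
  pose e := cmod (f s - f t) - k%:R * dist s.
  have e0 : 0 < e by rewrite subr_gt0.
  exists (e / (2 * C)); first by rewrite divr_gt0// mulr_gt0.
  move=> g Hg gf Bg; have := Bg _ srho; apply/negP; rewrite -ltNge.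
  have Hgf := hilbB hH Hg Hf.
  have gfC : cmod ((g - f) s - (g - f) t) <= C * N (g - f).
    apply: (le_trans (cmodD_le _ _)); rewrite cmodN.
    apply: (le_trans (lerD (sC _ Hgf) (tC _ Hgf))); rewrite -mulrDl.
    rewrite ler_wpM2r ?qnorm_ge0// /C -addrA lerD ?ler_norm//.
    by rewrite (le_trans (ler_norm _))// lerDl.
  have fge : cmod (f s - f t) <= cmod (g s - g t) + cmod ((g - f) s - (g - f) t).
    rewrite -[cmod ((g - f) s - _)]cmodN; apply: le_trans (cmodD_le _ _).
    rewrite le_eqVlt; apply/orP; left; apply/eqP; congr cmod.
    by rewrite !fctE; ring.
  have CN : C * N (g - f) <= e / 2.
    by move: gf; rewrite ler_pdivlMr ?mulr_gt0//; lra.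
  by rewrite /e in e0 CN; lra.
- move=> f Hf; have [M [r [r0 Mr]]] := lip f Hf.
  pose k := maxn (Num.truncn `|M|).+1 (Num.truncn (rho / r)).+1.
  have Mk : M <= k%:R.
    apply: (le_trans (ler_norm M)); apply: (le_trans (ltW (truncnS_gt _))).
    by rewrite ler_nat leq_maxl.
  have rk : rho / r < k%:R.
    by apply: (lt_le_trans (truncnS_gt _)); rewrite ler_nat leq_maxr.
  exists k => s sk; apply: (@le_trans _ _ (M * dist s)); last first.
    by rewrite ler_wpM2r.
  apply: Mr; apply: (lt_le_trans sk); rewrite ler_pdivrMr ?ltr0n//.
  move: rk; rewrite ltr_pdivrMr// => /ltW/le_trans; apply.
  by rewrite mulrC ler_pM2l// ler_nat.
exists (2 * k%:R / d), (rho / k.+1%:R); split.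
- by rewrite divr_ge0 ?mulr_ge0// ltW.
- by rewrite divr_gt0// ltr0n.
move=> s sk h Hh.
rewrite (mulrAC (2 * k%:R)).
apply: (bounded_of_ball hH (L := fun h => h s - h t) (m := 2 * k%:R * dist s)) => //.
- by move=> c g _; rewrite scalerBr.
(* [g] is the difference of [f + g] and [f], both in [B k]; hence the factor 2. *)
move=> g Hg gd.
have fg : cmod ((f + g) s - (f + g) t) <= k%:R * dist s.
  by apply: fB => //; [exact: hilbD hH _ _ Hf Hg|rewrite addrC addKr].
have ff : cmod (f s - f t) <= k%:R * dist s.
  by apply: fB => //; rewrite subrr (qnorm0 hH) ltW.
rewrite (_ : g s - g t = ((f + g) s - (f + g) t) - (f s - f t)).
  by apply: (le_trans (cmodD_le _ _)); rewrite cmodN; lra.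
by rewrite !fctE; ring.
Qed.

End hilbertian_baire.

Section hilbertian_comparison.
Context (R : realType) (T : Type) (H H' : set (T -> Cplx R))
  (Q Q' : (T -> Cplx R) -> R).
Hypothesis hH' : hilbertian H' Q'.
Hypotheses (subH : H' `<=` H) (leQ : forall f, H' f -> Q f <= Q' f).

(** Expanding around [k], the cross term is [2 * kappa'], while [Q k'] is at most [kappa']. *)
Lemma reproducing_dist t k k' kappa kappa' :
  reproducing H Q t k kappa -> reproducing H' Q' t k' kappa' ->
  Q (k' - k) <= kappa - kappa'.
Proof.
move=> [Hk kt Qk kP] [Hk' kt' Qk' kP'].
by rewrite kP ?kt'; [have := leQ Hk'; rewrite Qk' /=; lra|exact: subH].
Qed.

(** The value of [ks] at [t] is bounded by Cauchy-Schwarz in [H'], its increment by the Lipschitz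
    estimate in [H]; then divide by the root of [ksp]. A constant found in [H] thus serves every
    such [H']. *)
Lemma reproducing_sqrt_le s t ks kt (ksp ktp m : R) : 0 <= m ->
  (forall f, H f -> cmod (f s - f t) <= m * qnorm Q f) ->
  reproducing H' Q' s ks ksp -> reproducing H' Q' t kt ktp ->
  Num.sqrt ksp <= Num.sqrt ktp + m.
Proof.
move=> m0 lip rs rt; have [Hk kE Qk kP] := rs.
have ks0 : 0 <= ksp by rewrite -Qk; exact: hilb_ge0 hH' _.
have kt0 : 0 <= ktp by case: rt => _ _ <- _; exact: hilb_ge0 hH' _.
have [->|ks_neq0] := eqVneq ksp 0; first by rewrite sqrtr0 addr_ge0// sqrtr_ge0.
have sks : 0 < Num.sqrt ksp by rewrite sqrtr_gt0 lt_neqAle eq_sym ks_neq0.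
rewrite -(ler_pM2r sks) -expr2 sqr_sqrtr// mulrDl.
have {1}-> : ksp = cmod (ks s) by rewrite kE cmod_real ger0_norm.
rewrite -[ks s](subrK (ks t)) addrC; apply: (le_trans (cmodD_le _ _)); apply: lerD.
  rewrite -(@ler_pXn2r _ 2)// ?nnegrE ?cmod_ge0 ?mulr_ge0 ?sqrtr_ge0//.
  by rewrite exprMn !sqr_sqrtr//; have := reproducing_bound hH' rt Hk; rewrite Qk.
apply: (le_trans (lip _ (subH Hk))); rewrite ler_wpM2l// /qnorm.
by rewrite ler_wsqrtr// -Qk leQ.
Qed.

End hilbertian_comparison.

(** * Weighted square-integrable functions: completeness *)

(** With [e k] the tail of the geometric series, [u - e] is nondecreasing and [u + e] nonincreasing,
    and the limit lies between them. *)
Lemma geometric_cvg (R : realType) (u : R^nat) (A : R) :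
  (forall k, `|u k.+1 - u k| <= A * 2^-1 ^+ k) ->
  exists2 l, u @ \oo --> l & forall k, `|l - u k| <= 2 * A * 2^-1 ^+ k.
Proof.
move=> uA; pose e k : R := 2 * A * 2^-1 ^+ k.
have eS k : e k = e k.+1 + A * 2^-1 ^+ k by rewrite /e exprS; field.
have e0 : e @ \oo --> (0 : R).
  by apply: (@cvg_geometric _ (2 * A)); rewrite ger0_norm ?invr_ge0// invf_lt1// ltr1n.
have lo : nondecreasing_seq (fun k => u k - e k).
  by apply/nondecreasing_seqP => k; have := uA k; rewrite (eS k) ler_norml; lra.
have hi : nonincreasing_seq (fun k => u k + e k).
  by apply/nonincreasing_seqP => k; have := uA k; rewrite (eS k) ler_norml; lra.
have A0 : 0 <= A by have := uA 0; rewrite expr0 mulr1; exact: le_trans.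
have e_ge0 k : 0 <= e k by rewrite !mulr_ge0// exprn_ge0// invr_ge0.
have lohi i j : u i - e i <= u j + e j.
  have := lo _ _ (leq_maxl i j); have := hi _ _ (leq_maxr i j).
  by have := e_ge0 (maxn i j); lra.
have clo : cvgn (fun k => u k - e k).
  apply: nondecreasing_is_cvgn => //.
  by exists (u 0 + e 0) => _ [k _ <-].
set l := limn (fun k => u k - e k).
exists l.
  rewrite (_ : u = fun k => (u k - e k) + e k); last by apply/funext => k; rewrite subrK.
  by rewrite -[l]addr0; apply: cvgD.
move=> k; rewrite ler_norml; apply/andP; split.
  have := nondecreasing_cvgn_le lo clo k; rewrite -/l /e; lra.
suff : l <= u k + e k by rewrite /e; lra.
by apply: limr_le => //; apply: nearW.
Qed.

Lemma cmod_ge_Re (R : realType) (w : Cplx R) : `|complex.Re w| <= cmod w.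
Proof.
rewrite -(@ler_pXn2r _ 2)// ?nnegrE ?cmod_ge0// cmod_sqr real_normK ?num_real//.
by rewrite lerDl sqr_ge0.
Qed.

Lemma cmod_ge_Im (R : realType) (w : Cplx R) : `|complex.Im w| <= cmod w.
Proof.
rewrite -(@ler_pXn2r _ 2)// ?nnegrE ?cmod_ge0// cmod_sqr real_normK ?num_real//.
by rewrite lerDr sqr_ge0.
Qed.

Section weighted_L2.
Context d (T : measurableType d) (R : realType) (nu : {measure set T -> \bar R}).
Variables (D : set T) (w : T -> R).
Hypotheses (mD : measurable D) (mw : measurable_fun D w).
Hypothesis (w_gt0 : forall z, D z -> 0 < w z).
Implicit Types f g h : T -> Cplx R.

(** For [leb], the notions of this section are convertible with [cmeasurable], [L2] and its squared
    norm. *)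
Definition cplx_measurable f :=
  measurable_fun D (fun z => complex.Re (f z)) /\
  measurable_fun D (fun z => complex.Im (f z)).

Definition wsq f z : R := cmod (f z) ^+ 2 * w z.

Definition sq_integrable f :=
  cplx_measurable f /\ (\int[nu]_(z in D) (wsq f z)%:E < +oo)%E.

Definition wnorm2 f : R := fine (\int[nu]_(z in D) (wsq f z)%:E)%E.

Lemma wsq_ge0 f z : D z -> 0 <= wsq f z.
Proof. by move=> Dz; rewrite mulr_ge0 ?exprn_ge0 ?cmod_ge0// ltW// w_gt0. Qed.

Lemma measurable_wsq f : cplx_measurable f -> measurable_fun D (wsq f).
Proof.
move=> [mRe mIm]; rewrite (_ : wsq f = fun z =>
    (complex.Re (f z) ^+ 2 + complex.Im (f z) ^+ 2) * w z); last first.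
  by apply/funext => z; rewrite /wsq cmod_sqr.
by apply: measurable_funM => //; apply: measurable_funD; apply: measurable_funX.
Qed.

Lemma cplx_measurableP (c : R[i]) f g : cplx_measurable f ->
  cplx_measurable g -> cplx_measurable (c *: f + g).
Proof.
move=> [fr fi] [gr gi]; case: c => a b; split.
  rewrite (_ : (fun z => _) = fun z => a * complex.Re (f z) - b * complex.Im (f z)
    + complex.Re (g z)).
    apply: measurable_funD => //; apply: measurable_funB; exact: measurable_funM.
  apply/funext => z; rewrite fctE /= fctE /= /GRing.scale /=.
  by case: (f z) => ? ?; case: (g z).
rewrite (_ : (fun z => _) = fun z => a * complex.Im (f z) + b * complex.Re (f z)
  + complex.Im (g z)).
  apply: measurable_funD => //; apply: measurable_funD; exact: measurable_funM.
apply/funext => z; rewrite fctE /= fctE /= /GRing.scale /=.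
by case: (f z) => ? ?; case: (g z).
Qed.

Lemma integrable_wsq f : sq_integrable f -> nu.-integrable D (EFin \o wsq f).
Proof.
move=> [mf foo]; apply/integrableP; split.
  by apply/measurable_EFinP; exact: measurable_wsq.
by under eq_integral => z /set_mem Dz do rewrite gee0_abs ?lee_fin ?wsq_ge0//.
Qed.

Lemma sq_integrableP (c : R[i]) f g : sq_integrable f -> sq_integrable g ->
  sq_integrable (c *: f + g).
Proof.
move=> If Ig; have mfg := cplx_measurableP c If.1 Ig.1; split => //.
(* An integrable majorant, from [|c f + g|^2 <= 2 |c f|^2 + 2 |g|^2]. *)
pose F z := (2 * cmod c ^+ 2) * wsq f z + 2 * wsq g z.
have IF : nu.-integrable D (EFin \o F).
  rewrite (_ : EFin \o F = (fun z => ((2 * cmod c ^+ 2)%:E * (wsq f z)%:E) +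
      (2%:E * (wsq g z)%:E))%E); last by apply/funext.
  by apply: integrableD => //; apply: integrableZl => //; exact: integrable_wsq.
have /integrableP[_] := IF; apply: le_lt_trans.
apply: ge0_le_integral => //.
- by move=> z Dz; rewrite lee_fin wsq_ge0.
- by apply/measurable_EFinP; exact: measurable_wsq.
- by apply: measurableT_comp => //; exact: measurable_int IF.
move=> z Dz; rewrite gee0_abs/= lee_fin.
  rewrite /F /wsq [X in cmod X](_ : _ = c * f z + g z)//.
  rewrite [leRHS](_ : _ = (2 * cmod (c * f z) ^+ 2 + 2 * cmod (g z) ^+ 2) * w z).
    rewrite ler_wpM2r ?(ltW (w_gt0 Dz))//.
    apply: (@le_trans _ _ ((cmod (c * f z) + cmod (g z)) ^+ 2)).
      by rewrite lerXn2r ?nnegrE ?addr_ge0 ?cmod_ge0 ?cmodD_le.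
    have := sqr_ge0 (cmod (c * f z) - cmod (g z)); lra.
  by rewrite cmodM; ring.
by apply: addr_ge0; apply: mulr_ge0; rewrite ?wsq_ge0// mulr_ge0// exprn_ge0// cmod_ge0.
Qed.

Lemma wnorm2_ge0 f : 0 <= wnorm2 f.
Proof.
by apply: fine_ge0; apply: integral_ge0 => z Dz; rewrite lee_fin wsq_ge0.
Qed.

Lemma wnorm2Z (c : R[i]) f : sq_integrable f ->
  wnorm2 (c *: f) = cmod c ^+ 2 * wnorm2 f.
Proof.
move=> If; rewrite /wnorm2 -[RHS]/(cmod c ^+ 2 * \int[nu]_(z in D) (wsq f z))%R.
rewrite -RintegralZl//; last exact: integrable_wsq.
congr fine; apply: eq_integral => z _; congr EFin.
by rewrite /wsq [X in cmod X](_ : _ = c * f z)// cmodM exprMn mulrA.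
Qed.

Lemma wnorm2_line (r : R) f h : sq_integrable f -> sq_integrable h ->
  wnorm2 (f + r%:C%C *: h) =
  (1 - r) * wnorm2 f + r * wnorm2 (f + h) - r * (1 - r) * wnorm2 h.
Proof.
move=> If Ih; have Ifh : sq_integrable (f + h).
  by rewrite -[f]scale1r; exact: sq_integrableP.
rewrite /wnorm2.
rewrite -[X in _ * X + _ - _]/(\int[nu]_(z in D) (wsq f z))%R.
rewrite -[X in _ + _ * X - _]/(\int[nu]_(z in D) (wsq (f + h) z))%R.
rewrite -[X in _ - _ * X]/(\int[nu]_(z in D) (wsq h z))%R.
have Z (c : R) g : sq_integrable g ->
    nu.-integrable D (EFin \o (fun z => c * wsq g z)).
  move=> Ig; rewrite (_ : EFin \o _ = (fun z => c%:E * (wsq g z)%:E)%E)//.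
  by apply: integrableZl => //; exact: integrable_wsq.
rewrite -!RintegralZl//; try exact: integrable_wsq.
rewrite -RintegralD//; try exact: Z.
rewrite -RintegralB//; first last.
- exact: Z.
- rewrite (_ : EFin \o _ = (fun z => ((1 - r) * wsq f z)%:E + (r * wsq (f + h) z)%:E)%E)//.
  by apply: integrableD => //; exact: Z.
congr fine; apply: eq_integral => z _; congr EFin; rewrite /wsq.
rewrite [X in cmod X ^+ 2 * _ = _](_ : _ = f z + r%:C%C * h z)//.
rewrite [X in _ + _ * (cmod X ^+ 2 * _) - _](_ : _ = f z + h z)//.
by rewrite !cmod_sqr; case: (f z) => a b; case: (h z) => x y /=; ring.
Qed.

Lemma wnorm2B_ae_eq f g h : cplx_measurable f -> cplx_measurable g ->
  cplx_measurable h -> {ae nu, forall z, D z -> f z = g z} ->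
  wnorm2 (f - h) = wnorm2 (g - h).
Proof.
move=> mf mg mh fg.
have mB k : cplx_measurable k -> measurable_fun D (fun z => (wsq (k - h) z)%:E).
  move=> mk; apply/measurable_EFinP; apply: measurable_wsq.
  by rewrite addrC -scaleN1r; exact: cplx_measurableP.
congr fine; apply: ge0_ae_eq_integral => //; try exact: mB.
- by move=> z Dz; rewrite lee_fin wsq_ge0.
- by move=> z Dz; rewrite lee_fin wsq_ge0.
by apply: filterS fg => z fg Dz; rewrite /wsq !fctE fg.
Qed.

Lemma riesz_fischer (u : nat -> T -> Cplx R) : (forall k, sq_integrable (u k)) ->
  (forall k, wnorm2 (u k.+1 - u k) <= 16^-1 ^+ k) ->
  exists2 g, sq_integrable g & exists C, forall k, wnorm2 (g - u k) <= C * 4^-1 ^+ k.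
Proof.
move=> Iu uC.
have Idiff f g : sq_integrable f -> sq_integrable g -> sq_integrable (f - g).
  by move=> If Ig; rewrite addrC -scaleN1r; exact: sq_integrableP.
have fin_wsq f : sq_integrable f ->
    (\int[nu]_(z in D) (wsq f z)%:E = (wnorm2 f)%:E)%E.
  move=> [mf foo]; rewrite fineK// ge0_fin_numE//.
  by apply: integral_ge0 => z Dz; rewrite lee_fin wsq_ge0.
(* [G = sum_k 4^k |u_(k+1) - u_k|^2 w] is integrable; where it is finite, [u]
   converges geometrically, with a rate controlled by [G]. *)
pose F k z : \bar R := (4 ^+ k * wsq (u k.+1 - u k) z)%:E.
have F0 k z : D z -> (0 <= F k z)%E.
  by move=> Dz; rewrite lee_fin mulr_ge0 ?exprn_ge0 ?wsq_ge0.
have mF k : measurable_fun D (F k).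
  apply/measurable_EFinP; apply: measurable_funM => //.
  by apply: measurable_wsq; exact: (Idiff _ _ _ _).1.
pose G z : \bar R := (\sum_(k <oo) F k z)%E.
have G0 z : D z -> (0 <= G z)%E.
  by move=> Dz; apply: nneseries_ge0 => k _ _; exact: F0.
have mG : measurable_fun D G.
  apply: (@ge0_emeasurable_sum _ _ _ D F predT) => // k z Dz _; exact: F0.
(* Term [k] integrates to at most [4^k * 16^-k = 4^-k]; comparison with the series of [2^-k] gives
   2. *)
have intG : (\int[nu]_(z in D) G z <= 2%:E)%E.
  rewrite integral_nneseries//.
  apply: (@le_trans _ _ (\sum_(k <oo) (geometric 1 4^-1 k)%:E)%E).
    apply: lee_nneseries => [k _ _|k _].
      by apply: integral_ge0 => z Dz; exact: F0.
    rewrite (_ : (\int[nu]_(z in D) F k z)%E = (4 ^+ k)%:E * (wnorm2 (u k.+1 - u k))%:E)%E.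
      rewrite -EFinM lee_fin /geometric /= mul1r.
      apply: (@le_trans _ _ (4 ^+ k * 16^-1 ^+ k)).
        by rewrite ler_wpM2l ?exprn_ge0.
      by rewrite -exprMn (_ : 4 * 16^-1 = 4^-1)//; field.
    rewrite -fin_wsq; last exact: Idiff.
    rewrite -ge0_integralZl_EFin//.
    - by move=> z Dz; rewrite lee_fin wsq_ge0.
    - apply/measurable_EFinP; apply: measurable_wsq; exact: (Idiff _ _ _ _).1.
  have geoE : (\sum_(k <oo) (2 / (2 ^ (k + 0.+1))%:R)%:E = 2%:E :> \bar R)%E.
    have /cvg_lim := @cvg_geometric_eseries_half R 2 0.
    by rewrite expr0 divr1; exact.
  rewrite -geoE; apply: lee_nneseries => [k _ _|k _]; rewrite lee_fin.
    by rewrite /geometric/= mul1r exprn_ge0// invr_ge0.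
  rewrite addn1 natrX exprS invfM mulrA divff// mul1r /geometric/= mul1r -exprVn.
  by rewrite lerXn2r ?nnegrE ?invr_ge0// lef_pV2 ?posrE//; lra.
have IG : nu.-integrable D G.
  apply/integrableP; split => //.
  under eq_integral => z /set_mem Dz do rewrite gee0_abs ?G0//.
  exact: le_lt_trans intG (ltry _).
have aeG := integrable_ae mD IG.
pose E := D `&` [set z | G z \is a fin_num].
have mE : measurable E by exact: emeasurable_fin_num.
have geo z : E z -> exists2 A, 0 <= A & 
    (forall k, cmod (u k.+1 z - u k z) <= A * 2^-1 ^+ k) /\ A ^+ 2 * w z = fine (G z).
  move=> [Dz Gz]; have wz := w_gt0 Dz.
  have G0z : 0 <= fine (G z) by apply: fine_ge0; exact: G0.
  (* A single term of the series is at most [G z]; solving for the modulus gives this constant. *)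
  exists (Num.sqrt (fine (G z) / w z)); first exact: sqrtr_ge0.
  split; last by rewrite sqr_sqrtr ?divfK ?gt_eqF// divr_ge0// ltW.
  move=> k; rewrite -(@ler_pXn2r _ 2)// ?nnegrE ?cmod_ge0 ?mulr_ge0 ?sqrtr_ge0 ?exprn_ge0 ?invr_ge0//.
  rewrite exprMn sqr_sqrtr ?divr_ge0 ?(ltW wz)// mulrAC ler_pdivlMr//.
  rewrite exprAC (_ : 2^-1 ^+ 2 = 4^-1 :> R); last by field.
  rewrite exprVn ler_pdivlMr ?exprn_gt0// mulrC.
  rewrite -lee_fin fineK//.
  rewrite -[leLHS]/(F k z); apply: le_trans (nneseries_lim_ge k.+1 _); last by move=> i _ _; exact: F0.
  by rewrite big_nat_recr//= leeDr// sume_ge0// => i _; exact: F0.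
(* Cutting off outside [E] makes the limits exist on all of [D], so that [g] is measurable. *)
pose v k z : Cplx R := (\1_E z)%:C%C * u k z.
pose g z : Cplx R := Complex (limn (fun k => complex.Re (v k z)))
  (limn (fun k => complex.Im (v k z))).
have cvg_part (P : Cplx R -> R) : (forall a b, P (a - b) = P a - P b) ->
    (forall a, `|P a| <= cmod a) -> forall z, E z ->
    (fun k => P (v k z)) @ \oo --> limn (fun k => P (v k z)) /\
    forall A, (forall k, cmod (u k.+1 z - u k z) <= A * 2^-1 ^+ k) ->
    forall k, `|limn (fun k => P (v k z)) - P (u k z)| <= 2 * A * 2^-1 ^+ k.
  move=> PB Ple z Ez; have [A A0 [Au _]] := geo z Ez.
  have vE k : v k z = u k z by rewrite /v indicE mem_set// mul1r.
  rewrite (_ : (fun k => P (v k z)) = fun k => P (u k z)); last first.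
    by apply/funext => k; rewrite vE.
  have lip B : (forall k, cmod (u k.+1 z - u k z) <= B * 2^-1 ^+ k) ->
      forall k, `|P (u k.+1 z) - P (u k z)| <= B * 2^-1 ^+ k.
    by move=> Bu k; rewrite -PB; exact: le_trans (Ple _) (Bu k).
  split; first by have [l ul _] := geometric_cvg (lip _ Au); rewrite (cvg_lim _ ul).
  move=> B Bu k; have [l ul lu] := geometric_cvg (lip _ Bu).
  by rewrite (cvg_lim _ ul).
have ReB (a b : Cplx R) : complex.Re (a - b) = complex.Re a - complex.Re b.
  by case: a => ? ?; case: b.
have ImB (a b : Cplx R) : complex.Im (a - b) = complex.Im a - complex.Im b.
  by case: a => ? ?; case: b.
have mv k : cplx_measurable (v k).
  have [[mr mi] _] := Iu k; split.
    rewrite (_ : (fun z => _) = fun z => \1_E z * complex.Re (u k z)).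
      by apply: measurable_funM => //; exact: measurable_indic.
    by apply/funext => z; rewrite /v; case: (u k z) => a b /=; rewrite mul0r subr0.
  rewrite (_ : (fun z => _) = fun z => \1_E z * complex.Im (u k z)).
    by apply: measurable_funM => //; exact: measurable_indic.
  by apply/funext => z; rewrite /v; case: (u k z) => a b /=; rewrite mul0r addr0.
have v0 z k : ~ E z -> v k z = 0.
  by move=> nEz; rewrite /v indicE memNset// mul0r.
have mg : cplx_measurable g.
  split.
    apply: (@measurable_fun_cvg _ _ _ D (fun k z => complex.Re (v k z))).
      by move=> k; exact: (mv k).1.
    move=> z Dz; have [Ez|nEz] := pselect (E z).
      exact: (cvg_part _ ReB (@cmod_ge_Re R) z Ez).1.
    rewrite /g/= (_ : (fun k => complex.Re (v k z)) = cst 0).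
      by rewrite lim_cst//; exact: cvg_cst.
    by apply/funext => k; rewrite v0.
  apply: (@measurable_fun_cvg _ _ _ D (fun k z => complex.Im (v k z))).
    by move=> k; exact: (mv k).2.
  move=> z Dz; have [Ez|nEz] := pselect (E z).
    exact: (cvg_part _ ImB (@cmod_ge_Im R) z Ez).1.
  rewrite /g/= (_ : (fun k => complex.Im (v k z)) = cst 0).
    by rewrite lim_cst//; exact: cvg_cst.
  by apply/funext => k; rewrite v0.
have mgu k : cplx_measurable (g - u k).
  by rewrite addrC -scaleN1r; apply: cplx_measurableP => //; exact: (Iu k).1.
have gu_le k : (\int[nu]_(z in D) (wsq (g - u k) z)%:E <= (16 * 4^-1 ^+ k)%:E)%E.
  (* Real and imaginary parts of [g - u k] are each at most [2 * A * 2^-k], whence 8; the bound 2 on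
     the integral of [G] makes it 16. *)
  apply: (@le_trans _ _ (\int[nu]_(z in D) ((8 * 4^-1 ^+ k)%:E * G z))%E).
    apply: ae_ge0_le_integral => //.
    - by move=> z Dz; rewrite lee_fin wsq_ge0.
    - by apply/measurable_EFinP; exact: measurable_wsq.
    - by move=> z Dz; rewrite mule_ge0 ?G0// lee_fin mulr_ge0// exprn_ge0// invr_ge0.
    - exact: measurable_funeM.
    apply: filterS aeG => z Gz Dz; have Ez : E z by split => //; exact: Gz.
    have [A A0 [Au Aw]] := geo z Ez.
    rewrite -(fineK (Gz Dz)) -EFinM lee_fin -Aw mulrA ler_wpM2r ?(ltW (w_gt0 Dz))//.
    rewrite cmod_sqr ReB ImB.
    have ha : `|complex.Re (g z) - complex.Re (u k z)| <= 2 * A * 2^-1 ^+ k.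
      exact: (cvg_part _ ReB (@cmod_ge_Re R) z Ez).2 A Au k.
    have hb : `|complex.Im (g z) - complex.Im (u k z)| <= 2 * A * 2^-1 ^+ k.
      exact: (cvg_part _ ImB (@cmod_ge_Im R) z Ez).2 A Au k.
    move: ha hb; set a := complex.Re _ - _; set b := complex.Im _ - _ => ha hb.
    rewrite (_ : 4^-1 = 2^-1 ^+ 2); last by field.
    rewrite -exprM mulnC exprM.
    rewrite -(real_normK (num_real a)) -(real_normK (num_real b)).
    have := normr_ge0 a; have := normr_ge0 b; nra.
  rewrite ge0_integralZl_EFin//.
  apply: (@le_trans _ _ ((8 * 4^-1 ^+ k)%:E * 2%:E)%E).
    by rewrite lee_pmul2l// ?lte_fin ?mulr_gt0// exprn_gt0.
  by rewrite -EFinM lee_fin; lra.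
exists g.
  rewrite -(subrK (u 0) g) -[g - u 0]scale1r; apply: sq_integrableP => //.
  by split => //; apply: le_lt_trans (gu_le 0) (ltry _).
exists 16 => k; rewrite -lee_fin fineK//.
rewrite ge0_fin_numE; first exact: le_lt_trans (gu_le k) (ltry _).
by apply: integral_ge0 => z Dz; rewrite lee_fin wsq_ge0.
Qed.

End weighted_L2.

(** Enlarge first the weight on [D], then the set of integration. *)
Lemma sq_integrable_subset d (T : measurableType d) (R : realType)
    (nu : {measure set T -> \bar R}) (D D' : set T) (w w' : T -> R)
    (f : T -> Cplx R) :
  measurable D -> measurable D' -> D `<=` D' ->
  measurable_fun D w -> measurable_fun D' w' ->
  (forall z, D z -> 0 < w z <= w' z) -> (forall z, D' z -> 0 < w' z) ->
  sq_integrable nu D' w' f ->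
  sq_integrable nu D w f /\ wnorm2 nu D w f <= wnorm2 nu D' w' f.
Proof.
move=> mD mD' DD' mw mw' w0 w'0 [mf foo].
have w_gt0 z : D z -> 0 < w z by move=> /w0/andP[].
have mfD : cplx_measurable D f.
  by case: mf => mr mi; split; exact: measurable_funS DD' _.
have le_int : (\int[nu]_(z in D) (wsq w f z)%:E <= \int[nu]_(z in D') (wsq w' f z)%:E)%E.
  apply: (@le_trans _ _ (\int[nu]_(z in D) (wsq w' f z)%:E)%E).
    apply: ge0_le_integral => //.
    - by move=> z Dz; rewrite lee_fin (wsq_ge0 w_gt0).
    - by apply/measurable_EFinP; exact: measurable_wsq.
    - apply/measurable_EFinP; apply: measurable_funS DD' _ => //.
      exact: measurable_wsq.
    by move=> z /w0/andP[_ ww']; rewrite lee_fin ler_wpM2l// exprn_ge0// cmod_ge0.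
  apply: ge0_subset_integral => //.
    by apply/measurable_EFinP; exact: measurable_wsq.
  by move=> z Dz; rewrite lee_fin (wsq_ge0 w'0).
have int_ge0 : (0 <= \int[nu]_(z in D) (wsq w f z)%:E)%E.
  by apply: integral_ge0 => z Dz; rewrite lee_fin (wsq_ge0 w_gt0).
have Dfoo := le_lt_trans le_int foo.
split; first by [].
by apply: fine_le => //; rewrite ge0_fin_numE//; exact: le_trans le_int.
Qed.

(** * Bergman spaces of admissible weights *)

(** The norm of [Cn R n] takes values in [R[i]]; its real part is the distance as an element of
    [R]. *)
Definition rdist (R : realType) (n : nat) (t s : Cn R n) : R :=
  complex.Re `|s - t|.

Lemma rdistE (R : realType) (n : nat) (t s : Cn R n) :
  `|s - t| = (rdist t s)%:C%C.
Proof. by rewrite /rdist RRe_real// normr_real. Qed.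

Lemma rdist_ge0 (R : realType) (n : nat) (t s : Cn R n) : 0 <= rdist t s.
Proof. by rewrite -lecR -rdistE normr_ge0. Qed.

Lemma rdistxx (R : realType) (n : nat) (t : Cn R n) : rdist t t = 0.
Proof. by apply: complexI; rewrite -rdistE subrr normr0. Qed.

Lemma nbhs_rdistP (R : realType) (n : nat) (t : Cn R n) (A : set (Cn R n)) :
  nbhs t A <-> exists2 r : R, 0 < r & forall s, rdist t s < r -> A s.
Proof.
split=> [/nbhs_normP[e /= e0 eA]|[r r0 rA]].
  have ee : e = (complex.Re e)%:C%C by rewrite RRe_real// gtr0_real.
  exists (complex.Re e); first by rewrite -ltcR -ee.
  by move=> s se; apply: eA; rewrite /= distrC rdistE ee ltcR.
apply/(@nbhs_normP _ (Cn R n)); exists r%:C%C => /=; first by rewrite ltcR.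
by move=> s /=; rewrite distrC rdistE ltcR; exact: rA.
Qed.

(** The constant is a bound for the differential plus 1, which absorbs the remainder. *)
Lemma differentiable_lipschitz_at (R : realType) (n : nat) (f : Cn R n -> Cplx R)
    (t : Cn R n) : differentiable f t ->
  exists M r : R, 0 < r /\
    forall s, rdist t s < r -> cmod (f s - f t) <= M * rdist t s.
Proof.
move=> /diff_locallyP[dc /eqaddoP/(_ 1 ltr01)/nbhs_normP[e /= e0 eP]].
have /linear_boundedP/pinfty_ex_gt0[M M0 MP] := (linear_bounded_continuous _).2 dc.
have ee : e = (complex.Re e)%:C%C by rewrite RRe_real// gtr0_real.
have ME : M = (complex.Re M)%:C%C by rewrite RRe_real// gtr0_real.
exists (1 + complex.Re M), (complex.Re e); split; first by rewrite -ltcR -ee.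
move=> s se; have := eP (s - t); rewrite /= sub0r normrN rdistE {1}ee ltcR.
move=> /(_ se); rewrite mul1r.
rewrite [X in `|X|](_ : _ = (f s - f t) - 'd f t (s - t)); last first.
  by rewrite !fctE /= subrK opprD addrA.
have := MP (s - t); rewrite rdistE ME -rmorphM /= !norm_cmod !lecR => dM fM.
rewrite -[f s - f t](subrK ('d f t (s - t))) mulrDl mul1r.
by apply: (le_trans (cmodD_le _ _)); exact: lerD.
Qed.

Definition sqn (R : realType) (n : nat) (D : set (Cn R n)) (mu : Cn R n -> R)
    (f : Cn R n -> Cplx R) : R := fine (sqnorm D mu f).

(** For completeness, Riesz-Fischer provides a limit in [L2], closedness a holomorphic
    representative of it, and distances ignore the change on a null set. *)
Lemma admissible_hilbertian (R : realType) (n : nat) (D : set (Cn R n))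
    (mu : Cn R n -> R) : open D -> admissible D mu ->
  hilbertian (L2H D mu) (sqn D mu).
Proof.
move=> /open_measurable_Cn mD [[mmu mu0] cl _].
have QE : sqn D mu = wnorm2 (leb R n) (D : set (CnL R n)) (mu : CnL R n -> R).
  by [].
rewrite QE.
split.
- split; first by move=> z _; exact: differentiable_cst.
  split; first by split; exact: measurable_cst.
  rewrite /sqnorm integral0_eq ?ltry// => z _.
  by rewrite /cmod ComplexField.Normc.normc0 expr0n mul0r.
- move=> c f g [hf If] [hg Ig]; split; last first.
    by have := sq_integrableP mD mmu mu0 c If Ig.
  move=> z Dz; apply: differentiableD; last exact: hg.
  by apply: differentiableZ; exact: hf.
- by move=> f; apply: wnorm2_ge0.
- by move=> c f [_ If]; exact: wnorm2Z If.
- by move=> r f h [_ If] [_ Ih]; exact: wnorm2_line If Ih.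
move=> u Hu uC.
have [f If [C fC]] := riesz_fischer mD mmu mu0 (fun k => (Hu k).2) uC.
have [|g Hg fg] := cl f If.
  move=> e e0; have h : (fun k => C * 4^-1 ^+ k) @ \oo --> (0 : R).
    by apply: cvg_geometric; rewrite ger0_norm ?invr_ge0// invf_lt1// ltr1n.
  have e2 : 0 < e ^+ 2 by rewrite exprn_gt0.
  have [k _ /(_ k (leqnn _)) /= kP] := cvgr_lt 0 h (e ^+ 2) e2.
  exists (u k); first exact: Hu.
  rewrite -(@ltr_pXn2r _ 2)// ?nnegrE ?sqrtr_ge0 ?ltW// sqr_sqrtr.
    exact: le_lt_trans (fC k) kP.
  exact: (wnorm2_ge0 (leb R n) mu0).
exists g => //; exists C => k.
by rewrite -(wnorm2B_ae_eq mD mmu mu0 If.1 Hg.2.1 (Hu k).2.1 fg).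
Qed.

(** Continuity at 0 with tolerance 1, rescaled; the radius [d / 2] passes from an open to a closed
    ball. *)
Lemma admissible_bounded_evaluation (R : realType) (n : nat) (D : set (Cn R n))
    (mu : Cn R n -> R) (t : Cn R n) : open D -> admissible D mu -> D t ->
  bounded_evaluation (L2H D mu) (sqn D mu) t.
Proof.
move=> oD aD Dt; have hH := admissible_hilbertian oD aD.
have [_ _ /(_ t Dt 0 (hilb0 hH) 1 ltr01)[d d0 dP]] := aD.
exists (1 / (d / 2)) => f Hf.
apply: (bounded_of_ball hH (L := fun f => f t) (d := d / 2)) => //.
  by rewrite divr_gt0.
move=> g Hg gd; have := dP g Hg; rewrite [g \- 0](_ : _ = g); last first.
  by apply/funext => z; rewrite /= subr0.
rewrite [0 t](_ : _ = 0)// subr0 => h; apply/ltW/h.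
by apply: (le_lt_trans gd); lra.
Qed.

(** If the normalized class is empty, rescaling shows that every function of the space vanishes at
    [t], so the zero kernel reproduces with [kappa = 0]. *)
Lemma bergman_reproducing (R : realType) (n : nat) (D : set (Cn R n))
    (mu : Cn R n -> R) (t : Cn R n) : open D -> admissible D mu -> D t ->
  exists kappa, reproducing (L2H D mu) (sqn D mu) t
    (fun z => bergman_kernel D mu z t) kappa.
Proof.
move=> oD aD Dt; have hH := admissible_hilbertian oD aD.
have bt := admissible_bounded_evaluation oD aD Dt.
rewrite /bergman_kernel; case: asboolP => [[f [Hf ft]]|norm0].
  have minE : minimal D mu t !=set0.
    have [|phi [Hphi phit phimin]] := minimal_exists hH bt.
      by exists f.
    exists phi; split; first by [].
    by move=> g [Hg gt]; apply: ler_wsqrtr; exact: phimin.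
  have [[Hphi phit] phimin] := xgetPex (cst 0) minE.
  rewrite -/(min_element D mu t) in Hphi phit phimin *.
  exists (sqn D mu (min_element D mu t))^-1.
  rewrite (_ : (fun z => _) = (sqn D mu (min_element D mu t))^-1%:C%C *: min_element D mu t).
    apply: minimal_reproducing => // g Hg gt.
    have := phimin g (conj Hg gt).
    by rewrite -(ler_pXn2r (n := 2))// ?nnegrE ?sqrtr_ge0// !(qnorm_sqr hH).
  apply/funext => z; rewrite [RHS](_ : _ = (sqn D mu (min_element D mu t))^-1%:C%C * min_element D mu t z)//.
  by rewrite mulrC fmorphV/= (qnorm_sqr hH).
have Ht f : L2H D mu f -> f t = 0.
  move=> Hf; apply/eqP/negPn/negP => ft; apply: norm0.
  exists ((f t)^-1 *: f); split; first exact: hilbZr hH _ _ Hf.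
  by rewrite [LHS](_ : _ = (f t)^-1 * f t)// mulVf.
exists 0; split => //.
- exact: hilb0 hH.
- by rewrite -(qnorm_sqr hH) (qnorm0 hH) expr0n.
move=> f Hf; have f0 : f - (fun=> 0) = f.
  by apply/funext => z; rewrite !fctE subr0.
by rewrite f0 Ht//= mulr0 subr0 addr0.
Qed.

(** * Convergence of the kernels *)

Lemma bergman_reproducing_diag (R : realType) (n : nat) (D : set (Cn R n))
    (mu : Cn R n -> R) (t : Cn R n) : open D -> admissible D mu -> D t ->
  reproducing (L2H D mu) (sqn D mu) t (fun z => bergman_kernel D mu z t)
    (complex.Re (bergman_kernel D mu t t)).
Proof.
move=> oD aD Dt; have [kappa kP] := bergman_reproducing oD aD Dt.
by have [_ kt _ _] := kP; rewrite kt.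
Qed.

Lemma bergman_diag_ge0 (R : realType) (n : nat) (D : set (Cn R n))
    (mu : Cn R n -> R) (t : Cn R n) : open D -> admissible D mu -> D t ->
  0 <= complex.Re (bergman_kernel D mu t t).
Proof.
move=> oD aD Dt; have [_ _ <- _] := bergman_reproducing_diag oD aD Dt.
exact: hilb_ge0 (admissible_hilbertian oD aD) _.
Qed.

Lemma bergman_evaluation_lipschitz (R : realType) (n : nat) (D : set (Cn R n))
    (mu : Cn R n -> R) (t : Cn R n) : open D -> admissible D mu -> D t ->
  exists M r : R, [/\ 0 <= M, 0 < r & forall s, rdist t s < r ->
    forall f, L2H D mu f -> cmod (f s - f t) <= M * rdist t s * qnorm (sqn D mu) f].
Proof.
move=> oD aD Dt; have [rho rho0 rhoD] := (nbhs_rdistP t D).1 (open_nbhs_nbhs (conj oD Dt)).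
apply: (evaluation_lipschitz (admissible_hilbertian oD aD) rho0).
- exact: rdist_ge0.
- exact: rdistxx.
- by move=> s /rhoD Ds; exact: admissible_bounded_evaluation.
by move=> f [hf _]; exact: differentiable_lipschitz_at (hf _ Dt).
Qed.

Lemma L2H_subset (R : realType) (n : nat) (D D' : set (Cn R n))
    (mu mu' : Cn R n -> R) (f : Cn R n -> Cplx R) :
  open D -> open D' -> D `<=` D' -> admissible D mu -> admissible D' mu' ->
  (forall z, D z -> mu z <= mu' z) -> L2H D' mu' f ->
  L2H D mu f /\ sqn D mu f <= sqn D' mu' f.
Proof.
move=> /open_measurable_Cn mD /open_measurable_Cn mD' DD'.
move=> [[mmu mu0] _ _] [[mmu' mu'0] _ _] le_mu [hf If].
have mumu' z : D z -> 0 < mu z <= mu' z by move=> Dz; rewrite mu0// le_mu.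
have [IfD leQ] := sq_integrable_subset mD mD' DD' mmu mmu' mumu' mu'0 If.
by split => //; split => // z /DD'; exact: hf.
Qed.

Section convergence.
Context (R : realType) (n : nat) (D : set (Cn R n)) (Ds : nat -> set (Cn R n))
  (mu : Cn R n -> R) (mus : nat -> Cn R n -> R).
Hypotheses (oD : open D) (oDs : forall m, open (Ds m))
  (DDs : forall m, D `<=` Ds m)
  (aD : admissible D mu) (aDs : forall m, admissible (Ds m) (mus m))
  (le_mus : forall m z, D z -> mu z <= mus m z).

Local Notation K := (bergman_kernel D mu).
Local Notation Km m := (bergman_kernel (Ds m) (mus m)).

Let subH m f (Hf : L2H (Ds m) (mus m) f) :=
  L2H_subset oD (@oDs m) (@DDs m) aD (@aDs m) (@le_mus m) Hf.

Lemma bergman_kernel_dist m z t : D z -> D t ->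
  cmod (Km m z t - K z t) ^+ 2 <=
  complex.Re (K z z) * (complex.Re (K t t) - complex.Re (Km m t t)).
Proof.
move=> Dz Dt; have hH := admissible_hilbertian oD aD.
have rt := bergman_reproducing_diag oD aD Dt.
have rmt := bergman_reproducing_diag (@oDs m) (@aDs m) (@DDs m _ Dt).
have := reproducing_dist (fun f Hf => (subH Hf).1) (fun f Hf => (subH Hf).2) rt rmt.
have [Hk _ _ _] := rt; have [/subH[Hkm _] _ _ _] := rmt.
have := reproducing_bound hH (bergman_reproducing_diag oD aD Dz) (hilbB hH Hkm Hk).
move=> /le_trans h Qle; apply: h; rewrite ler_wpM2l//.
exact: bergman_diag_ge0.
Qed.

Lemma bergman_diag_le m t : D t ->
  complex.Re (Km m t t) <= complex.Re (K t t).
Proof.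
move=> Dt; have hH := admissible_hilbertian oD aD.
have rt := bergman_reproducing_diag oD aD Dt.
have rmt := bergman_reproducing_diag (@oDs m) (@aDs m) (@DDs m _ Dt).
have := reproducing_dist (fun f Hf => (subH Hf).1) (fun f Hf => (subH Hf).2) rt rmt.
by move=> /(le_trans (hilb_ge0 hH _)); rewrite subr_ge0.
Qed.

(** [y - y'] factors through the square roots, whose sum is at most [2 * a]. *)
Lemma mulr_sqr_diff_le (x y y' c a d : R) : 0 <= x -> 0 <= y -> 0 <= y' ->
  y' <= y -> Num.sqrt x <= c -> Num.sqrt y <= a -> Num.sqrt y - Num.sqrt y' <= d ->
  x * (y - y') <= c ^+ 2 * (2 * a * d).
Proof.
move=> x0 y0 y'0 y'y xc ya yd; have sy'y := ler_wsqrtr y'y.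
have [sx0 sy0 sy'0] := And3 (sqrtr_ge0 x) (sqrtr_ge0 y) (sqrtr_ge0 y').
rewrite -[x]sqr_sqrtr// -[y]sqr_sqrtr// -[y']sqr_sqrtr//.
move: (Num.sqrt x) (Num.sqrt y) (Num.sqrt y') sx0 sy0 sy'0 xc ya yd sy'y.
move=> p q q' p0 q0 q'0 pc qa qd q'q; apply: ler_pM.
- exact: exprn_ge0.
- by rewrite subr_ge0 lerXn2r// nnegrE.
- by rewrite lerXn2r// nnegrE (le_trans p0).
rewrite subr_sqr mulrC; apply: ler_pM => //; last lra.
- exact: addr_ge0.
- by rewrite subr_ge0.
Qed.

(** Convergence at the one diagonal point [t0] controls all nearby points, as the Lipschitz estimate
    at [t0] has the same constant for every [m]. *)
Lemma bergman_near_cvg z0 t0 (e : R) : D z0 -> D t0 -> 0 < e ->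
  (fun m => Km m t0 t0) @ \oo --> K t0 t0 ->
  \forall p \near (z0, t0) & m \near \oo, D p.1 -> D p.2 ->
    cmod (Km m p.1 p.2 - K p.1 p.2) < e.
Proof.
move=> Dz0 Dt0 e0 Kt0; have hH := admissible_hilbertian oD aD.
have [Mz [rz [Mz0 rz0 zlip]]] := bergman_evaluation_lipschitz oD aD Dz0.
have [M [r [M0 r0 tlip]]] := bergman_evaluation_lipschitz oD aD Dt0.
have K_ge0 t : D t -> 0 <= complex.Re (K t t) by exact: bergman_diag_ge0.
have Km_ge0 m t : D t -> 0 <= complex.Re (Km m t t).
  by move=> Dt; apply: bergman_diag_ge0 => //; exact: DDs.
have sub0 f : L2H D mu f -> L2H D mu f by [].
have le0 f : L2H D mu f -> sqn D mu f <= sqn D mu f by [].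
pose c0 := Num.sqrt (complex.Re (K z0 z0)) + Mz.
pose a0 := Num.sqrt (complex.Re (K t0 t0)).
pose b0 m := Num.sqrt (complex.Re (Km m t0 t0)).
pose C := c0 ^+ 2 * (2 * (a0 + M)) + 1.
have c0_ge0 : 0 <= c0 by rewrite addr_ge0// sqrtr_ge0.
have a0_ge0 : 0 <= a0 by exact: sqrtr_ge0.
have C0 : 0 < C by rewrite ltr_wpDl// !mulr_ge0// ?exprn_ge0// addr_ge0.
(* Chosen so that the final bound [(C - 1) * 3 * eta] stays below [4 * C * eta = e ^+ 2]. *)
pose eta := e ^+ 2 / (4 * C).
have eta0 : 0 < eta by rewrite divr_gt0 ?exprn_gt0// mulr_gt0.
have ReKt0 : (fun m => complex.Re (Km m t0 t0)) @ \oo --> complex.Re (K t0 t0).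
  apply/cvgrPdist_lt => d d0.
  move/cvgrPdist_lt : Kt0 => /(_ d%:C%C); rewrite ltcR => /(_ d0).
  apply: filterS => m; rewrite norm_cmod ltcR => /(le_lt_trans _); apply.
  by rewrite -raddfB; exact: cmod_ge_Re.
have b0cvg : b0 @ \oo --> a0 by exact: cvg_comp ReKt0 (@sqrt_continuous _ _).
have near_t : \forall t \near t0, rdist t0 t < Num.min r (Num.min 1 (eta / (M + 1))).
  apply/nbhs_rdistP; exists (Num.min r (Num.min 1 (eta / (M + 1)))) => //.
  by rewrite !lt_min r0 ltr01 divr_gt0//; lra.
have near_z : \forall z \near z0, rdist z0 z < Num.min rz 1.
  by apply/nbhs_rdistP; exists (Num.min rz 1) => //; rewrite lt_min rz0 ltr01.
have near_m : \forall m \near \oo, a0 - b0 m < eta.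
  move/cvgrPdist_lt : b0cvg => /(_ _ eta0); apply: filterS => m.
  by apply: le_lt_trans; exact: ler_norm.
exists ([set p | rdist z0 p.1 < Num.min rz 1 /\
    rdist t0 p.2 < Num.min r (Num.min 1 (eta / (M + 1)))],
    [set m | a0 - b0 m < eta]).
  by split => //=; exists ([set z | rdist z0 z < Num.min rz 1],
    [set t | rdist t0 t < Num.min r (Num.min 1 (eta / (M + 1)))]).
move=> [[z t] m] /= [[]]; rewrite !lt_min => /andP[zr z1] /and3P[tr t1 teta] ab Dz Dt.
have cle : Num.sqrt (complex.Re (K z z)) <= c0.
  have := reproducing_sqrt_le hH sub0 le0 _ (zlip z zr)
    (bergman_reproducing_diag oD aD Dz) (bergman_reproducing_diag oD aD Dz0).
  move=> /(_ (mulr_ge0 Mz0 (rdist_ge0 _ _)))/le_trans; apply.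
  by rewrite lerD2l ler_piMr// ltW.
pose a := Num.sqrt (complex.Re (K t t)).
pose b := Num.sqrt (complex.Re (Km m t t)).
have ale : a <= a0 + M * rdist t0 t.
  exact: (reproducing_sqrt_le hH sub0 le0 (mulr_ge0 M0 (rdist_ge0 t0 t)) (tlip t tr)
    (bergman_reproducing_diag oD aD Dt) (bergman_reproducing_diag oD aD Dt0)).
(* The comparison now runs from [t0] to [t], for kernels of [Ds m] but with the Lipschitz estimate
   of [D]. *)
have ble : b0 m <= b + M * rdist t0 t.
  apply: (reproducing_sqrt_le (admissible_hilbertian (@oDs m) (@aDs m))
    (fun f Hf => (subH Hf).1) (fun f Hf => (subH Hf).2) (mulr_ge0 M0 (rdist_ge0 t0 t)) _
    (bergman_reproducing_diag (@oDs m) (@aDs m) (@DDs m _ Dt0))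
    (bergman_reproducing_diag (@oDs m) (@aDs m) (@DDs m _ Dt))).
  by move=> f Hf; rewrite -cmodN opprB; exact: tlip.
have Md : M * rdist t0 t <= eta.
  apply: (@le_trans _ _ ((M + 1) * rdist t0 t)).
    by rewrite ler_wpM2r ?rdist_ge0//; lra.
  by rewrite mulrC -ler_pdivlMr ?ltW//; lra.
have Md1 : M * rdist t0 t <= M by rewrite ler_piMr// ltW.
have aA : a <= a0 + M by lra.
(* The sum of [a - a0], [a0 - b0 m] and [b0 m - b], each at most [eta]. *)
have ab3 : a - b <= 3 * eta by lra.
rewrite -(@ltr_pXn2r _ 2)// ?nnegrE ?cmod_ge0 ?ltW//.
apply: (le_lt_trans (bergman_kernel_dist m Dz Dt)).
apply: (le_lt_trans (mulr_sqr_diff_le (K_ge0 z Dz) (K_ge0 t Dt) (Km_ge0 m t Dt)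
  (bergman_diag_le m Dt) cle aA ab3)).
have -> : e ^+ 2 = 4 * C * eta by rewrite /eta; field; lra.
rewrite [ltLHS](_ : _ = (C - 1) * 3 * eta); last by rewrite /C; ring.
by rewrite ltr_pM2r//; lra.
Qed.

End convergence.

(** Regularity yields a closed neighbourhood inside [D]; it is compact as a closed subset of
    [closure B]. In the theorem, [B] is some [Ds m]. *)
Lemma compact_nbhs_subset (T : uniformType) (B D : set T) (x : T) :
  compact (closure B) -> D `<=` B -> nbhs x D ->
  exists W : set T, [/\ nbhs x W, compact W & W `<=` D].
Proof.
move=> cB DB xD; have [W xW WD] := uniform_regular xD.
exists (closure W); split => //.
- exact: filterS (@subset_closure _ W) xW.
- apply: subclosed_compact cB _; first exact: closed_closure.
  by move=> z /WD /DB; exact: subset_closure.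
Qed.

Lemma uniform_cvg_cmodP (R : realType) (T : choiceType) (A : set T)
    (F : nat -> T -> Cplx R) (G : T -> Cplx R) :
  {uniform A, F @ \oo --> G} <->
  forall e : R, 0 < e ->
    \forall m \near \oo, forall y, A y -> cmod (F m y - G y) < e.
Proof.
split=> [FG e e0|FG P /uniform_nbhs[E [entE EP]]].
  have [|N _ NP] := FG [set h | forall y, A y -> ball (G y) e%:C%C (h y)].
    apply/uniform_nbhs; exists [set xy | ball xy.1 e%:C%C xy.2]; split => //.
    by rewrite -entourage_ballE; exists e%:C%C => //=; rewrite ltcR.
  exists N => // m Nm y Ay; have := NP m Nm y Ay.
  by rewrite -ball_normE /= distrC norm_cmod ltcR.
move: entE; rewrite -entourage_ballE => -[e /= e0 eE].
have ee : e = (complex.Re e)%:C%C by rewrite RRe_real// gtr0_real.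
have [|N _ NP] := FG (complex.Re e); first by rewrite -ltcR -ee.
exists N => // m Nm; apply: EP => y Ay; apply: eE.
by rewrite /= -ball_normE /= distrC norm_cmod ee ltcR; exact: NP.
Qed.

Unset Implicit Arguments.
Set Strict Implicit.
Set Printing Implicit Defensive.

Theorem theorem11 (R : realType) (n : nat)
    (D : set (Cn R n)) (Ds : nat -> set (Cn R n))
    (mu : Cn R n -> R) (mus : nat -> Cn R n -> R)
    (domD : domain D) (intD : D = (closure D)°)
    (domDs : forall m, domain (Ds m))
    (approx : approximates_from_outside Ds D)
    (admD : admissible D mu) (admDs : forall k, admissible (Ds k) (mus k))
    (le_mus : forall m z, D z -> mu z <= mus m z)
    (cvg_mus : {ae leb R n, forall z, D z -> (fun k => mus k z) @ \oo --> mu z}) :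
  locally_uniform_cvg (D `*` D)
    (fun m p => bergman_kernel (Ds m) (mus m) p.1 p.2)
    (fun p => bergman_kernel D mu p.1 p.2)
  <->
  (forall t, D t ->
    (fun m => bergman_kernel (Ds m) (mus m) t t) @ \oo --> bergman_kernel D mu t t).
Proof.
have [oD _ _] := domD.
have oDs m : open (Ds m) by case: (domDs m).
have [DDs outer] := approx.
split=> [lu t Dt|ptw [z0 t0] [/= Dz0 Dt0]].
  have [U Utt /uniform_cvg_cmodP unifU] := lu (t, t) (conj Dt Dt).
  apply/cvgrPdist_lt => e e0.
  have ee : e = (complex.Re e)%:C%C by rewrite RRe_real// gtr0_real.
  have [|N _ NP] := unifU (complex.Re e); first by rewrite -ltcR -ee.
  exists N => // m Nm; rewrite /= distrC norm_cmod ee ltcR.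
  by apply: (NP m Nm (t, t)); split => //; exact: nbhs_singleton.
(* Taking the whole space for [G] shows that some [Ds m0] has compact closure. *)
have [m0 _ /(_ m0 (leqnn _)) [_ cDs _]] := outer setT openT (@subsetT _ _).
have [W1 [z0W cW1 W1D]] := compact_nbhs_subset cDs (DDs m0) (open_nbhs_nbhs (conj oD Dz0)).
have [W2 [t0W cW2 W2D]] := compact_nbhs_subset cDs (DDs m0) (open_nbhs_nbhs (conj oD Dt0)).
exists (W1 `*` W2); first by exists (W1, W2).
apply/uniform_cvg_cmodP => e e0.
(* Compactness merges the local estimates, each with its own threshold on [m], into one threshold
   for the product of [W1] and [W2]. *)
have /compact_near_coveringP cover := compact_setX cW1 cW2.
have mW : \forall m \near \oo, W1 `*` W2 `<=` [set p | D p.1 -> D p.2 ->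
    cmod (bergman_kernel (Ds m) (mus m) p.1 p.2 - bergman_kernel D mu p.1 p.2) < e].
  apply: cover => -[z t] [/= /W1D Dz /W2D Dt].
  exact: (bergman_near_cvg oD oDs DDs admD admDs le_mus Dz Dt e0 (ptw t Dt)).
by apply: filterS mW => m mW p [pW [Dp1 Dp2]]; exact: mW.
Qed.
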